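(* Let $n\ge2$ and $N\geq1$. On $H_{\infty/n}=\Lambda^*(\xi_1,\dots,\xi_{n-1})\otimes\mathbb C[u_1,\dots,u_{n-1}]$ the differential $d_N$ obeys the graded Leibniz rule, vanishes on every $u_i$, and is given on the $\xi_i$ by $$d_N(\xi_i)=\sum_{i_1+\cdots+i_N=i}u_{i_1}u_{i_2}\cdots u_{i_N},$$ the sum being over ordered $N$-tuples of integers $i_j\ge1$. Equivalently, setting $\xi=\xi_1t+\xi_2t^2+\dots+\xi_{n-1}t^{n-1}$ and $u=u_1t+u_2t^2+\dots+u_{n-1}t^{n-1}$, one has $d_N\xi=u^N$ modulo $t^n$ (with $d_N$ extended $t$-linearly).
   Context: Let $R\subset\mathbb C[x_1,\dots,x_n]$ be the subring generated by the $x_i-x_j$, and realize the reflection representation as $\mathfrak h=\{\sum c_ie_i:\sum c_i=0\}\subset\mathbb C^n$. As $m\to\infty$ the spaces $\mathrm{Hom}_{S_n}(\Lambda^*\mathfrak h,L_{m/n})$, where $L_{m/n}$ is the finite-dimensional irreducible representation of the rational Cherednik algebra of type $A_{n-1}$ with parameter $m/n$ (a quotient of $R$ by an ideal generated in degree $m$), stabilize in each degree to $H_{\infty/n}=\mathrm{Hom}_{S_n}(\Lambda^*\mathfrak h,R)$. We identify an element of $\mathrm{Hom}_{S_n}(\Lambda^k\mathfrak h,R)$ with an $S_n$-invariant polynomial $k$-form, and extend forms on $\mathfrak h$ to forms $\sum\varphi_{I}\,e_I^*$ on $\mathbb C^n$ via the orthogonal projection $\mathbb C^n\to\mathfrak h$;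 multiplication is the wedge product. Generators: let $a_k(\lambda)$ be defined by $p_k=\sum_{\lambda\vdash k}a_k(\lambda)e_\lambda$ (power sums in terms of elementary symmetric functions) and put, for $1\le k\le n-1$, $$u_k=\sum_{\lambda\vdash k+1}a_{k+1}(\lambda)\Big(\prod_i\tfrac{(n-\lambda_i)!}{n!}\Big)e_\lambda(x_1,\dots,x_n),$$ (with $e_j=0$ terms omitted for $j>n$), which lies in $R^{S_n}$, and $\xi_k=\frac1{k+1}\sum_i\frac{\partial u_k}{\partial x_i}e_i^*\in\mathrm{Hom}_{S_n}(\mathfrak h,R)$. The $u_k$ freely generate $R^{S_n}$ and $H_{\infty/n}=\Lambda^*(\xi_1,\dots,\xi_{n-1})\otimes\mathbb C[u_1,\dots,u_{n-1}]$. The filtration on $H_{\infty/n}$ is the increasing filtration induced by the multiplicative grading $f$ with $f(u_i)=1-i$, $f(\xi_i)=-i$ (the level-$i$ piece is spanned by $f$-homogeneous elements of $f$-degree $\le i$). Differential: for $N\ge1$ let $\partial_N:\mathrm{Hom}_{S_n}(\Lambda^k\mathfrak h,R)\to\mathrm{Hom}_{S_n}(\Lambda^{k-1}\mathfrak h,R)$ be contraction with $\sum_i\tilde x_i^N e_i$, where $\tilde x_i=x_i-\frac1n\sum_jx_j$ (for $k=1$: $\partial_N(\sum_i\varphi_ie_i^* )=\sum_i\tilde x_i^N\varphi_i$); it raises the filtration level by at most $N$. $d_N$ is the induced map on the associated graded, i.e. the component of $\partial_N$ raising $f$ by exactly $N$, viewed on $H_{\infty/n}\cong\mathrm{gr}\,H_{\infty/n}$.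 *)

(* Defs.v *)
From HB Require Import structures.
From mathcomp Require Import all_boot all_order all_algebra.
From mathcomp Require Import fingroup perm.
From mathcomp Require Import mpoly.
From mathcomp Require classical_sets.
From mathcomp Require Import reals complex.
Set Implicit Arguments.
Unset Strict Implicit.
Unset Printing Implicit Defensive.
Import Order.TTheory GRing.Theory Num.Theory.
Local Open Scope ring_scope.

(* [extalg A m] is the exterior algebra over A on generators e_0, ..., e_(m-1):
   the value at I = {i_1 < ... < i_k} is the coefficient of
   e_{i_1} /\ ... /\ e_{i_k}.  The ring product is the wedge product. *)
Definition extalg (A : comNzRingType) (m : nat) := {ffun {set 'I_m} -> A}.

HB.instance Definition _ (A : comNzRingType) (m : nat) :=
  GRing.Zmodule.copy (extalg A m) {ffun {set 'I_m} -> A}.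

Definition inversions (m : nat) (I J : {set 'I_m}) : nat :=
  #|[set p : 'I_m * 'I_m | [&& p.1 \in I, p.2 \in J & (p.2 < p.1)%N]]|.

Section ExteriorAlgebra.
Variables (A : comNzRingType) (m : nat).
Implicit Types (p q r : extalg A m) (I J K : {set 'I_m}).

Definition ext_one : extalg A m := [ffun I => (I == set0)%:R].

Definition ext_mul p q : extalg A m :=
  [ffun K : {set 'I_m} => \sum_(I : {set 'I_m} | I \subset K)
     (-1) ^+ inversions I (K :\: I) * (p I * q (K :\: I))].

Definition ext_scale (c : A) p : extalg A m := [ffun I => c * p I].

Definition ext_gen (i : 'I_m) : extalg A m := [ffun I => (I == [set i])%:R].

Lemma inversions0l J : inversions set0 J = 0%N.
Proof. by apply: eq_card0 => x; rewrite !inE. Qed.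

Lemma inversions0r I : inversions I set0 = 0%N.
Proof. by apply: eq_card0 => x; rewrite !inE andbF. Qed.

Lemma inversionsUl I J K : [disjoint I & J] ->
  inversions (I :|: J) K = (inversions I K + inversions J K)%N.
Proof.
move=> dIJ; rewrite /inversions -cardsUI [X in (_ + X)%N]eq_card0 ?addn0.
  by apply: eq_card => x; rewrite !inE -andb_orl.
move=> x; rewrite !inE; case: (boolP (x.1 \in I)) => //= xI.
by rewrite (disjointFr dIJ xI) /= andbF.
Qed.

Lemma inversionsUr I J K : [disjoint J & K] ->
  inversions I (J :|: K) = (inversions I J + inversions I K)%N.
Proof.
move=> dJK; rewrite /inversions -cardsUI [X in (_ + X)%N]eq_card0 ?addn0.
  by apply: eq_card => x; rewrite !inE -andb_orr -andb_orl.
move=> x; rewrite !inE; case: (boolP (x.2 \in J)) => [xJ|xJ]; last by rewrite andbF.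
by rewrite (disjointFr dJK xJ) /= !andbF.
Qed.

Lemma ext_mulA : associative ext_mul.
Proof.
move=> p q r; apply/ffunP=> K; rewrite !ffunE; symmetry.
under eq_bigr => H _ do rewrite ffunE mulr_suml mulr_sumr.
rewrite (exchange_big_dep (fun I => I \subset K)) /=; last first.
  by move=> H I HK IH; exact: subset_trans IH HK.
apply: eq_bigr => I IK; rewrite ffunE !mulr_sumr.
rewrite (reindex_onto (fun J : {set 'I_m} => I :|: J) (fun H => H :\: I)) /=;
    last first.
  move=> H /andP[HK IH]; apply/setP=> x; rewrite !inE.
  by case: (boolP (x \in I)) => //= /(subsetP IH).
apply: eq_big => [J|J].
  rewrite subUset IK subsetUl andbT /= subsetD; congr (_ && _).
  apply/eqP/idP => [<-|dJI].
    by rewrite disjoint_sym disjoints_subset; apply/subsetP=> x; rewrite !inE => ->.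
  apply/setP=> x; rewrite !inE; case: (boolP (x \in J)) => xJ.
    by rewrite (disjointFr dJI xJ).
  by rewrite orbF andNb.
move=> /andP[/andP[sJK _] /eqP defJ].
have dIJ : [disjoint I & J].
  by rewrite disjoints_subset -defJ; apply/subsetP=> x; rewrite !inE => ->.
have -> : K :\: (I :|: J) = K :\: I :\: J by rewrite setDDl.
rewrite defJ; set L := K :\: I :\: J.
have dIL : [disjoint J & L].
  by rewrite disjoints_subset; apply/subsetP=> x xJ; rewrite !inE xJ.
have -> : K :\: I = J :|: L.
  apply/setP=> x; rewrite !inE; case: (boolP (x \in J)) => //= xJ.
  rewrite (disjointFl dIJ xJ) /=.
  by move/subsetP: sJK; apply; rewrite inE xJ orbT.
rewrite inversionsUl // inversionsUr // !exprD.
set a := _ ^+ _; set b := _ ^+ _; set c := _ ^+ _.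
rewrite !mulrA; do 2!congr (_ * _).
by rewrite [RHS]mulrAC; congr (_ * _); rewrite [LHS]mulrC mulrA.
Qed.

Lemma ext_mul1l : left_id ext_one ext_mul.
Proof.
move=> p; apply/ffunP=> K; rewrite ffunE (bigD1 set0) ?sub0set //= big1.
  by rewrite !ffunE eqxx inversions0l setD0 !mul1r addr0.
by move=> I /andP[_ /negPf I0]; rewrite ffunE I0 mul0r mulr0.
Qed.

Lemma ext_mul1r : right_id ext_one ext_mul.
Proof.
move=> p; apply/ffunP=> K; rewrite ffunE (bigD1 K) //= big1.
  by rewrite !ffunE setDv eqxx inversions0r mul1r mulr1 addr0.
move=> I /andP[IK neIK]; rewrite ffunE setD_eq0.
by rewrite (_ : _ \subset _ = false) ?mulr0 //; apply: contraNF neIK => KI; rewrite eqEsubset IK.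
Qed.

Lemma ext_mulDl : left_distributive ext_mul +%R.
Proof.
move=> p q r; apply/ffunP=> K; rewrite !ffunE -big_split /=.
by apply: eq_bigr => I _; rewrite ffunE mulrDl mulrDr.
Qed.

Lemma ext_mulDr : right_distributive ext_mul +%R.
Proof.
move=> p q r; apply/ffunP=> K; rewrite !ffunE -big_split /=.
by apply: eq_bigr => I _; rewrite ffunE !mulrDr.
Qed.

Lemma ext_one_neq0 : ext_one != 0.
Proof.
by apply/eqP=> /ffunP/(_ set0)/eqP; rewrite !ffunE eqxx oner_eq0.
Qed.

HB.instance Definition _ := GRing.Zmodule_isNzRing.Build (extalg A m)
  ext_mulA ext_mul1l ext_mul1r ext_mulDl ext_mulDr ext_one_neq0.

Lemma ext_scaleA (a b : A) p : ext_scale a (ext_scale b p) = ext_scale (a * b) p.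
Proof. by apply/ffunP=> I; rewrite !ffunE mulrA. Qed.

Lemma ext_scale1 : left_id 1 ext_scale.
Proof. by move=> p; apply/ffunP=> I; rewrite !ffunE mul1r. Qed.

Lemma ext_scaleDr : right_distributive ext_scale +%R.
Proof. by move=> a p q; apply/ffunP=> I; rewrite !ffunE mulrDr. Qed.

Lemma ext_scaleDl p : {morph ext_scale^~ p : a b / a + b}.
Proof. by move=> a b; apply/ffunP=> I; rewrite !ffunE mulrDl. Qed.

HB.instance Definition _ := GRing.Zmodule_isLmodule.Build A (extalg A m)
  ext_scaleA ext_scale1 ext_scaleDr ext_scaleDl.

Lemma ext_scaleAl (a : A) p q : a *: (p * q) = (a *: p) * q.
Proof.
apply/ffunP=> K; rewrite !ffunE mulr_sumr.
by apply: eq_bigr => I _; rewrite ffunE mulrCA !mulrA.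
Qed.

HB.instance Definition _ := GRing.Lmodule_isLalgebra.Build A (extalg A m)
  ext_scaleAl.

Lemma ext_scaleAr (a : A) p q : a *: (p * q) = p * (a *: q).
Proof.
apply/ffunP=> K; rewrite !ffunE mulr_sumr.
by apply: eq_bigr => I _; rewrite ffunE mulrCA; congr (_ * _); rewrite mulrCA.
Qed.

HB.instance Definition _ := GRing.Lalgebra_isAlgebra.Build A (extalg A m)
  ext_scaleAr.

(* Contraction with the vector \sum_i v_i e_i. *)
Definition contraction (v : 'I_m -> A) p : extalg A m :=
  [ffun J : {set 'I_m} => \sum_(i | i \notin J)
     (-1) ^+ #|[set j in J | (j < i)%N]| * (v i * p (i |: J))].

End ExteriorAlgebra.

Section PowerSums.
Variable F : fieldType.

Definition powsum (n k : nat) : {mpoly F[n]} := \sum_(i < n) 'X_i ^+ k.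

Lemma powsum_sym n k : powsum n k \is symmetric.
Proof.
apply/issymP=> s; rewrite /powsum raddf_sum /=.
rewrite [RHS](reindex_inj (@perm_inj _ s)) /=.
apply: eq_bigr => i _; rewrite rmorphXn /= msymX; congr ('X_[_] ^+ _).
apply/mnmP=> j; rewrite !mnmE; congr (nat_of_bool _).
by rewrite -(inj_eq (@perm_inj _ s)) permKV.
Qed.

Lemma powsum_homog n k : powsum n k \is k.-homog.
Proof.
apply: rpred_sum => i _.
have /(dhomogMn k) : 'X_i \is [in F[n], 1.-homog] by rewrite dhomogX /= mdeg1.
by rewrite mul1n.
Qed.

(* A partition of k is encoded by its multiplicities: [lam : 'X_{1..k}] has
   [lam i] parts equal to i+1, and its size is [mnmwgt lam].  The identity
   p_k = \sum_(lam |- k) a_k(lam) e_lam of symmetric functions is of degree k,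
   hence equivalent to the same identity in k variables. *)
Definition powsum_elem (k : nat) : {mpoly F[k]} :=
  sval (sym_fundamental_homog (powsum_sym k k) (powsum_homog k k)).

Definition acoef (k : nat) (lam : 'X_{1..k}) : F := (powsum_elem k)@_lam.

Definition elem_part (n k : nat) (lam : 'X_{1..k}) : {mpoly F[n]} :=
  \prod_(i < k) mesym n F i.+1 ^+ lam i.

Lemma acoefP k : powsum k k =
  \sum_(lam : 'X_{1..k < k.+1} | mnmwgt lam == k)
    acoef lam *: elem_part k lam.
Proof.
rewrite /acoef /powsum_elem; case: sym_fundamental_homog => t /= [<- homt].
have szt : (msize t <= k.+1)%N.
  rewrite msizeE; apply/bigmax_leqP_seq => lam lam_t _.
  have := leq_mdeg_mnmwgt lam.
  by rewrite (dhomogP _ _ _ homt lam lam_t) ltnS.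
rewrite (comp_mpolywE _ szt) (bigID (fun lam => mnmwgt (bmnm lam) == k)) /=.
rewrite [X in _ + X]big1 ?addr0 => [|lam /(dhomog_nemf_coeff homt) ->]; last first.
  by rewrite scale0r.
apply: eq_bigr => lam _; congr (_ *: _).
by apply: eq_bigr => i _; rewrite tnth_mktuple.
Qed.
End PowerSums.

Section CherednikForms.
Variables (F : fieldType) (n : nat).

Local Notation poly := {mpoly F[n]}.
(* Polynomial differential forms on F^n; [dx i] is e_i^*. *)
Definition pform := extalg {mpoly F[n]} n.

(* The subring R generated by the differences of the variables. *)
Inductive in_R : poly -> Prop :=
| in_R_const (c : F) : in_R c%:MP
| in_R_diff (i j : 'I_n) : in_R ('X_i - 'X_j)
| in_R_add (p q : poly) : in_R p -> in_R q -> in_R (p + q)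
| in_R_mul (p q : poly) : in_R p -> in_R q -> in_R (p * q).

Definition dx (i : 'I_n) : pform := ext_gen _ i.

(* \prod_(i in I) multiplies in increasing order of i, so the sign of the
   permutation induced on I is accounted for by the ring structure. *)
Definition sym_act (s : 'S_n) (phi : pform) : pform :=
  \sum_(I : {set 'I_n}) msym s (phi I) *: \prod_(i in I) dx (s i).

(* Extension of phi|_h to F^n by the orthogonal projection of F^n onto the
   hyperplane h of vectors with zero sum: e_i^* is replaced by
   e_i^* - 1/n \sum_j e_j^*. *)
Definition ext_from_h (phi : pform) : pform :=
  \sum_(I : {set 'I_n}) phi I *:
    \prod_(i in I) (dx i - (n%:R^-1 : F)%:MP *: \sum_(j < n) dx j).

(* H_(oo/n) = Hom_{S_n}(Lambda^* h, R): the S_n-invariant forms with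
   coefficients in R which are the extension of their own restriction to h. *)
Definition in_H (phi : pform) : Prop :=
  [/\ forall I, in_R (phi I), ext_from_h phi = phi
    & forall s, sym_act s phi = phi].

(* Hom_{S_n}(Lambda^k h, R) *)
Definition in_Hk (k : nat) (phi : pform) : Prop :=
  in_H phi /\ forall I : {set 'I_n}, #|I| != k -> phi I = 0.

(* A part lam_i > n contributes 0, since mesym n F j = 0 for j > n. *)
Definition u (k : nat) : poly :=
  \sum_(lam : 'X_{1..k.+1 < k.+2} | mnmwgt lam == k.+1)
    (acoef F lam * \prod_(i < k.+1) ((n - i.+1)`!%:R / n`!%:R) ^+ lam i)
      *: elem_part F n lam.

Definition xi (k : nat) : pform :=
  \sum_(i < n) ((k.+1%:R^-1 : F) *: (u k)^`M(i)) *: dx i.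

Definition xtilde (i : 'I_n) : poly :=
  'X_i - (n%:R^-1 : F) *: \sum_(j < n) 'X_j.

Definition partialN (N : nat) (phi : pform) : pform :=
  contraction (fun i => xtilde i ^+ N) phi.

(* Lambda^*(xi_1, ..., xi_(n-1)) (x) F[u_1, ..., u_(n-1)] as an abstract
   algebra, and its map to forms.  The generators are indexed by 'I_n.-1,
   with i : 'I_n.-1 standing for the index i+1. *)
Definition fmodel := extalg {mpoly F[n.-1]} n.-1.

Definition realize (a : fmodel) : pform :=
  \sum_(S : {set 'I_n.-1})
    (a S \mPo [tuple u i.+1 | i < n.-1]) *: \prod_(i in S) xi i.+1.

Definition coords (phi : pform) : fmodel :=
  classical_sets.xget 0 (fun a => realize a = phi).

(* f-degree of the monomial u^m xi_S: f(u_i) = 1 - i and f(xi_i) = - i. *)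
Definition fdeg (S : {set 'I_n.-1}) (m : 'X_{1..n.-1}) : int :=
  \sum_(i < n.-1) (1 - i.+1%:Z) *+ m i - \sum_(i in S) i.+1%:Z.

Definition fdegs (a : fmodel) : seq int :=
  undup [seq fdeg J m | J <- enum {: {set 'I_n.-1}}, m <- msupp (a J)].

Definition fcomp (d : int) (a : fmodel) : fmodel :=
  [ffun J => \sum_(m <- msupp (a J) | fdeg J m == d) (a J)@_m *: 'X_[m]].

(* [fhomog d] is spanned by the monomials of f-degree d, [ffilt d] by those of
   f-degree at most d. *)
Definition fhomog (d : int) (phi : pform) : Prop :=
  exists2 a, all (fun e => e == d) (fdegs a) & realize a = phi.

Definition ffilt (d : int) (phi : pform) : Prop :=
  exists2 a, all (fun e => e <= d) (fdegs a) & realize a = phi.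

(* The map gr_d -> gr_(d+N) induced by [partialN N], where gr_d is identified
   with the f-homogeneous elements of degree d. *)
Definition gr_partial (N : nat) (d : int) (phi : pform) : pform :=
  classical_sets.xget 0 (fun psi =>
    fhomog (d + N%:Z) psi /\ ffilt (d + N%:Z - 1) (partialN N phi - psi)).

(* d_N on H: decompose phi into f-homogeneous components, and apply the induced
   map on the associated graded to each of them. *)
Definition dN (N : nat) (phi : pform) : pform :=
  \sum_(d <- fdegs (coords phi))
    gr_partial N d (realize (fcomp d (coords phi))).

End CherednikForms.

(* Main.v *)
Require Import Defs.
From HB Require Import structures.
From mathcomp Require Import all_boot all_order all_algebra.
From mathcomp Require Import fingroup perm.
From mathcomp Require Import mpoly.
From mathcomp Require Import reals complex.
From mathcomp Require Import ring zify.
Set Implicit Arguments.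
Unset Strict Implicit.
Unset Printing Implicit Defensive.
Import Order.TTheory GRing.Theory Num.Theory.
Local Open Scope ring_scope.

(** Let xt_i be the centred variables, D_N the derivation sum_i xt_i^N d/dx_i and
    eh_k = (n-k)!/n! e_k the normalised elementary symmetric functions. The u_k
    are related to the eh_k as power sums are to the e_k, up to the shift of
    index; so Newton's identities, which are polynomial identities in the e_k,
    say that the generating series of the eh_k has the logarithmic derivative
    sum_k (-1)^k u_k t^k (newton_nmesym). The contraction of xi_k with
    sum_i xt_i^N e_i is q_(N,k) = D_N u_k / (k+1), and these are the coefficients,
    up to sign, of the logarithmic D_N-derivative of the same series
    (vder_nmesym). Since xt_i * d/dx_i acts on the e_k in a simple way, one gets
    for k < n the recursion (qcoefS)
      q_(N+1,k) = sum_(a+b=k, a>=1) u_a q_(N,b) + (n-1-k) q_(N,k+1),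
    starting with q_(0,k) = [k = 0] (qcoef0). For k = n - 1 the last summand
    vanishes, so all the q_(N,k) are polynomials in u_1, ..., u_(n-1). The first
    summand alone would produce the coefficient of t^k in u^N, of f-degree N - k;
    the second one has f-degree lower by at least two and contributes lower terms
    (qmodel_deg). This is the formula for d_N on the xi_k.

    To deduce the statement about d_N, which is defined through the coordinates
    of forms in the model algebra, the realisation map from the model to forms
    must be injective with image containing H.

    Injectivity: with P(z) = prod_j (z + x_j), the one-form dP at z = -x_i is
    P'(-x_i) dx_i, and it is a combination of the de_k, hence of xi_0, ...,
    xi_(n-1). So a nonzero multiple of the volume form is a multiple of the
    product of the xi_k, which is thus nonzero (prod_xi_neq0). Therefore the
    products of the xi_k are linearly independent over polynomials
    (ext_lift_inj), and differentiating a polynomial relation between the u_k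
    lowers its degree, which makes the u_k algebraically independent
    (u_alg_indep).

    Surjectivity onto H: symmetrising monomials shows that the invariant forms on
    F^n are generated by the power sums of x_i^a and of x_i^a dx_i
    (invariant_closure). Projecting to h sends the former to n q_(a,0), a
    polynomial in the u_k, and the latter to the differential of such a
    polynomial, a combination of the xi_k (realize_surj).

    Contraction with a vector is an antiderivation (contractionM). Hence it is
    determined on the model by its values on the xi_k, its leading part is the
    contraction with the coefficients of u^N (dN_realize), and the latter is
    again an antiderivation that kills the u_k. *)

(** * Exterior algebras: multiplication by generators *)

Section ExtBasics.
Variables (A : comNzRingType) (m : nat).
Implicit Types (p q : extalg A m) (I J K : {set 'I_m}).

Lemma ext0E I : (0 : extalg A m) I = 0.
Proof. by rewrite ffunE. Qed.

Lemma ext1E I : (1 : extalg A m) I = (I == set0)%:R.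
Proof. by rewrite ffunE. Qed.

Lemma extDE p q I : (p + q) I = p I + q I.
Proof. by rewrite ffunE. Qed.

Lemma extNE p I : (- p) I = - p I.
Proof. by rewrite ffunE. Qed.

Lemma extZE (c : A) p I : (c *: p) I = c * p I.
Proof. by rewrite ffunE. Qed.

Lemma ext_sumE (T : Type) (r : seq T) (P : pred T) (f : T -> extalg A m) I :
  (\sum_(t <- r | P t) f t) I = \sum_(t <- r | P t) f t I.
Proof. by elim/big_rec2: _ => [|t x y _ <-]; rewrite ?ext0E ?extDE. Qed.

Lemma extME p q K : (p * q) K =
  \sum_(I : {set 'I_m} | I \subset K)
     (-1) ^+ inversions I (K :\: I) * (p I * q (K :\: I)).
Proof. by rewrite ffunE. Qed.

Lemma inversions1l i J : inversions [set i] J = #|[set j in J | (j < i)%N]|.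
Proof.
have inj : injective (@pair 'I_m 'I_m i) by move=> a b [].
rewrite /inversions -(card_imset _ inj); apply: eq_card => -[a b].
rewrite !inE /=; apply/and3P/imsetP => [[/eqP-> bJ lt]|[c]].
  by exists b; rewrite // inE bJ.
by rewrite inE => /andP[cJ lt] [-> ->]; split.
Qed.

Lemma ext_genM i q K : (ext_gen A i * q) K =
  (if i \in K then (-1) ^+ inversions [set i] (K :\ i) * q (K :\ i) else 0).
Proof.
rewrite extME; case: ifP => iK.
  rewrite (bigD1 [set i]) ?sub1set //= ffunE eqxx mul1r big1 ?addr0 //.
  by move=> I /andP[_ /negPf neI]; rewrite ffunE neI mul0r mulr0.
rewrite big1 // => I sIK; rewrite ffunE; case: eqP => [eI|_]; last first.
  by rewrite mul0r mulr0.
by move: sIK; rewrite eI sub1set iK.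
Qed.

Lemma ext_genM_gen i j K : (ext_gen A i * ext_gen A j) K =
  ((i != j) && (K == [set i; j]))%:R * (-1) ^+ (j < i)%N.
Proof.
rewrite ext_genM ffunE; have [<-|neij] /= := eqVneq i j.
  rewrite mulr0n mul0r (_ : (_ == _) = false) ?mulr0n ?mulr0 ?if_same //.
  by apply/eqP => /setP/(_ i); rewrite !inE eqxx.
have [->|neK] := eqVneq K; last first.
  rewrite mulr0n mul0r; case: ifP => // iK;
    rewrite (_ : (_ == _) = false) ?mulr0 //.
  by apply: contra_neqF neK => /eqP <-; rewrite setD1K.
have -> : [set i; j] :\ i = [set j] by rewrite setU1K // inE.
rewrite !inE !eqxx /= mulr1 mul1r inversions1l; congr (_ ^+ _).
case: ltnP => ltji.
  by rewrite (_ : [set _ in _ | _] = [set j]) ?cards1 //; apply/setP => x;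
     rewrite !inE; case: eqP => // ->.
apply: eq_card0 => x; rewrite !inE; apply/andP => -[/eqP->].
by rewrite ltnNge ltji.
Qed.
End ExtBasics.


Lemma mulr_signCA (B : nzRingType) (e : nat) (x y : B) :
  x * ((-1) ^+ e * y) = (-1) ^+ e * (x * y).
Proof. by rewrite !mulrA commr_sign. Qed.

Lemma mulr_signK (B : nzRingType) (e : nat) (x : B) :
  (-1) ^+ e * ((-1) ^+ e * x) = x.
Proof. by rewrite mulrA -expr2 sqrr_sign mul1r. Qed.

Lemma ord_index_enumE n : index_enum 'I_n = enum 'I_n.
Proof. by rewrite enumT [index_enum _]unlock. Qed.

(** The relations satisfied by the elements of degree one of an exterior
    algebra, hence the condition under which an assignment of the generators
    extends to a ring morphism (ext_liftM below). *)
Definition alternating (B : nzRingType) k (v : 'I_k -> B) :=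
  (forall i, v i * v i = 0) /\ (forall i j, v i * v j = - (v j * v i)).

Section Alternating.
Variables (B : nzRingType) (k : nat) (v : 'I_k -> B).
Hypothesis alt_v : alternating v.
Implicit Types (I J : {set 'I_k}).

(* In an increasing enumeration, v i crosses exactly the v j with j in I and
   j < i on the way to its place. *)
Let alt_mulr_seq i I (r : seq 'I_k) : i \notin I -> i \in r ->
  sorted (fun a b : 'I_k => a < b)%N r ->
  v i * \prod_(j <- r | j \in I) v j =
  (-1) ^+ count (fun j : 'I_k => (j \in I) && (j < i)%N) r
   * \prod_(j <- r | j \in i |: I) v j.
Proof.
have trans : transitive (fun a b : 'I_k => a < b)%N.
  by move=> a b c; apply: ltn_trans.
have [_ alt] := alt_v => iI; elim: r => // a r IHr.
rewrite inE /= => air; rewrite (path_sortedE trans) => /andP[/allP lt_a sr].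
rewrite !big_cons !inE.
have [eia|neia] /= := eqVneq i a.
  subst a; rewrite (negPf iI) /= add0n.
  rewrite (_ : count _ _ = 0%N); last first.
    apply/eqP; rewrite eqn0Ngt -has_count; apply/hasPn => b /lt_a.
    by rewrite negb_and -leqNgt => /ltnW ->; rewrite orbT.
  rewrite mul1r; congr (_ * _); rewrite big_seq_cond [RHS]big_seq_cond.
  apply: eq_bigl => b; case: (boolP (b \in r)) => //= /lt_a lt_ib.
  by rewrite !inE (_ : b == i = false) //; apply: contraTF lt_ib => /eqP ->;
     rewrite ltnn.
move: air; rewrite (negPf neia) /= => ir.
rewrite (lt_a _ ir) andbT.
case: (boolP (a \in I)) => aI; last by rewrite add0n IHr.
rewrite add1n exprS !mulrA alt mulN1r !mulNr -!mulrA; congr (- _).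
by rewrite IHr // mulr_signCA.
Qed.

Lemma alt_mulr i I : i \notin I ->
  v i * \prod_(j in I) v j =
  (-1) ^+ inversions [set i] I * \prod_(j in i |: I) v j.
Proof.
have srt : sorted (fun a b : 'I_k => a < b)%N (index_enum 'I_k).
  have : sorted ltn (map val (enum 'I_k)).
    by rewrite val_enum_ord iota_ltn_sorted.
  by rewrite ord_index_enumE sorted_map.
move=> iI; rewrite (alt_mulr_seq iI (mem_index_enum i) srt) inversions1l.
congr (_ ^+ _ * _); rewrite -size_filter cardE ord_index_enumE; congr size.
by rewrite enumT /enum_mem /=; apply: eq_filter => j; rewrite !inE.
Qed.

Lemma alt_mulr0 i I : i \in I -> v i * \prod_(j in I) v j = 0.
Proof.
move=> iI; have [alt0 _] := alt_v.
have niI : i \notin I :\ i by rewrite !inE eqxx.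
have := alt_mulr niI; rewrite setD1K // => /(congr1 (fun x => v i * x)).
rewrite mulrA alt0 mul0r mulr_signCA => /esym.
by move/(congr1 (fun x => (-1) ^+ inversions [set i] (I :\ i) * x));
   rewrite mulr_signK mulr0.
Qed.

Lemma alt_mul I J :
  (\prod_(i in I) v i) * (\prod_(j in J) v j) =
  if [disjoint I & J] then (-1) ^+ inversions I J * \prod_(j in I :|: J) v j
  else 0.
Proof.
have [n leIn] := ubnP #|I|; elim: n => // n IHn in I J leIn *.
have [->|[i iI]] := set_0Vmem I.
  by rewrite big_set0 mul1r disjoints_subset sub0set inversions0l mul1r set0U.
set I' := I :\ i.
have niI' : i \notin I' by rewrite !inE eqxx.
have sz : (#|I'| < n)%N by move: leIn; rewrite (cardsD1 i I) iI.
have defI : i |: I' = I by rewrite setD1K.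
have := alt_mulr niI'; rewrite defI.
move/(congr1 (fun x => (-1) ^+ inversions [set i] I' * x)).
rewrite mulr_signK => <-; rewrite -!mulrA IHn // -defI.
rewrite [in RHS]disjoints_subset subUset sub1set inE -disjoints_subset.
case: (boolP [disjoint I' & J]) => dI'J; last by rewrite andbF !mulr0.
rewrite andbT mulr_signCA; case: ifPn => [niJ|/negPn iJ]; last first.
  by rewrite alt_mulr0 ?mulr0 // inE iJ orbT.
have niIJ : i \notin I' :|: J by rewrite inE negb_or niI'.
have dii : [disjoint [set i] & I'] by rewrite disjoints_subset sub1set inE.
rewrite alt_mulr // setUA inversionsUl // inversionsUr // !exprD -!mulrA.
by rewrite mulr_signCA mulr_signK mulr_signCA.
Qed.
End Alternating.

Section ExtBasis.
Variables (A : comNzRingType) (m : nat).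
Implicit Types (p q : extalg A m) (I J K : {set 'I_m}).

Lemma ext_signE e p K : ((-1) ^+ e * p) K = (-1) ^+ e * p K.
Proof.
rewrite -signr_odd -[in RHS]signr_odd; case: (odd e).
  by rewrite !mulN1r extNE.
by rewrite !mul1r.
Qed.

Lemma ext_sign e p : (-1) ^+ e * p = (-1) ^+ e *: p.
Proof. by apply/ffunP => K; rewrite ext_signE extZE. Qed.

Lemma ext_gen_alternating : alternating (@ext_gen A m).
Proof.
split=> [i|i j]; apply/ffunP => K.
  by rewrite ext_genM_gen eqxx mul0r ext0E.
rewrite extNE !ext_genM_gen eq_sym [[set j; i]]setUC.
have [->|neij] /= := eqVneq j i; first by rewrite !mul0r oppr0.
case: (K == _); last by rewrite !mul0r oppr0.
rewrite !mul1r; case: (ltngtP i j) => [||/val_inj/eqP]; rewrite ?opprK //.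
by rewrite eq_sym (negPf neij).
Qed.

Lemma prod_ext_genE I K : (\prod_(i in I) ext_gen A i) K = (K == I)%:R.
Proof.
have [n leIn] := ubnP #|I|; elim: n => // n IHn in I K leIn *.
have [->|[i iI]] := set_0Vmem I; first by rewrite big_set0 ext1E.
set I' := I :\ i.
have niI' : i \notin I' by rewrite !inE eqxx.
have sz : (#|I'| < n)%N by move: leIn; rewrite (cardsD1 i I) iI.
have := alt_mulr ext_gen_alternating niI'; rewrite setD1K //.
move/(congr1 (fun x => (-1) ^+ inversions [set i] I' * x)).
rewrite mulr_signK => <-; rewrite ext_signE ext_genM IHn //.
have [iK|niK] := ifP; last first.
  by rewrite mulr0; case: eqP => // eKI; rewrite eKI iI in niK.
have [->|neK] := eqVneq K I; first by rewrite eqxx mulr_signK.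
rewrite (_ : (_ == _) = false) ?mulr0 //; apply: contra_neqF neK => /eqP eD.
by rewrite -(setD1K iK) eD setD1K.
Qed.

Lemma ext_decomp p :
  p = \sum_(I : {set 'I_m}) p I *: \prod_(i in I) ext_gen A i.
Proof.
apply/ffunP => K; rewrite ext_sumE (bigD1 K) //= [X in _ + X]big1.
  by rewrite extZE prod_ext_genE eqxx mulr1 addr0.
by move=> I /negPf neI; rewrite extZE prod_ext_genE eq_sym neI mulr0.
Qed.

(** An induction principle for statements that are linear in p and are
    transported by left multiplication with a generator. *)
Lemma ext_ind (P : extalg A m -> Prop) :
  (forall p q, P p -> P q -> P (p + q)) -> (forall c p, P p -> P (c *: p)) ->
  P 1 -> (forall i p, P p -> P (ext_gen A i * p)) -> forall p, P p.
Proof.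
move=> PD PZ P1 PM p; rewrite (ext_decomp p).
have P0 : P 0 by rewrite -(scale0r 1); apply: PZ.
apply: (big_ind P) => // I _; apply: (PZ).
have [n leIn] := ubnP #|I|; elim: n => // n IHn in I leIn *.
have [->|[i iI]] := set_0Vmem I; first by rewrite big_set0.
set I' := I :\ i.
have niI' : i \notin I' by rewrite !inE eqxx.
have sz : (#|I'| < n)%N by move: leIn; rewrite (cardsD1 i I) iI.
have := alt_mulr ext_gen_alternating niI'; rewrite setD1K //.
move/(congr1 (fun x => (-1) ^+ inversions [set i] I' * x)).
rewrite mulr_signK ext_sign => <-; apply: PZ; apply: PM; exact: IHn.
Qed.

Definition ext_homog (r : nat) p := forall I, #|I| != r -> p I = 0.

Lemma ext_homogM r s p q :
  ext_homog r p -> ext_homog s q -> ext_homog (r + s)%N (p * q).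
Proof.
move=> hp hq K neK; rewrite extME big1 // => I sIK.
have [eI|neI] := eqVneq #|I| r; last by rewrite hp // mul0r mulr0.
rewrite hq ?mulr0 //; apply: contra neK => /eqP <-.
by rewrite -eI cardsD (setIidPr sIK) subnKC // subset_leq_card.
Qed.

Lemma ext_homog1 : ext_homog 0 1.
Proof. by move=> I; rewrite ext1E cards_eq0 => /negPf->. Qed.

Lemma ext_homogZ r c p : ext_homog r p -> ext_homog r (c *: p).
Proof. by move=> hp I /hp; rewrite extZE => ->; rewrite mulr0. Qed.

Lemma ext_homogD r p q : ext_homog r p -> ext_homog r q -> ext_homog r (p + q).
Proof. by move=> hp hq I neI; rewrite extDE hp // hq // addr0. Qed.

Lemma ext_homog_sum r T (s : seq T) (P : pred T) (f : T -> extalg A m) :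
  (forall t, P t -> ext_homog r (f t)) -> ext_homog r (\sum_(t <- s | P t) f t).
Proof.
move=> hf; apply: (big_ind (ext_homog r)) => //; last exact: ext_homogD.
by move=> I _; rewrite ext0E.
Qed.

Lemma ext_homog_prod T (s : seq T) (f : T -> extalg A m) :
  (forall t, ext_homog 1 (f t)) -> ext_homog (size s) (\prod_(t <- s) f t).
Proof.
move=> hf; elim: s => [|t s IHs]; rewrite ?big_nil ?big_cons;
  first exact: ext_homog1.
exact: (@ext_homogM 1).
Qed.

Lemma ext_homog_gen i : ext_homog 1 (ext_gen A i).
Proof.
by move=> I neI; rewrite ffunE; case: (I =P _) neI => // ->; rewrite cards1.
Qed.

Lemma ext_homog1E p : ext_homog 1 p -> p = \sum_i p [set i] *: ext_gen A i.
Proof.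
move=> hp; apply/ffunP => K; rewrite ext_sumE.
have [/cards1P[i ->]|neK] := boolP (#|K| == 1%N); last first.
  rewrite hp // big1 // => i _; rewrite extZE ffunE.
  by case: (K =P _) neK => [->|_ _]; rewrite ?cards1 ?mulr0.
rewrite (bigD1 i) //= big1 ?addr0; first by rewrite extZE ffunE eqxx mulr1.
move=> j neji; rewrite extZE ffunE (inj_eq set1_inj) eq_sym (negPf neji).
by rewrite mulr0.
Qed.

Lemma ext_homog1_anticomm p q : ext_homog 1 p -> ext_homog 1 q ->
  p * q = - (q * p).
Proof.
move=> hp hq; rewrite (ext_homog1E hp) (ext_homog1E hq) !mulr_suml -sumrN.
under eq_bigr do rewrite mulr_sumr.
rewrite exchange_big; apply: eq_bigr => j _; rewrite mulr_sumr -sumrN.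
apply: eq_bigr => i _; rewrite -!scalerAl -!scalerAr.
by rewrite ext_gen_alternating.2 !scalerN !scalerA mulrC.
Qed.

Lemma ext_homog1_sqr p : ext_homog 1 p -> p * p = 0.
Proof.
move=> hp; rewrite (ext_homog1E hp).
pose x (s : seq 'I_m) := \sum_(i <- s) p [set i] *: ext_gen A i.
suff hx s : x s * x s = 0 by apply: (hx (index_enum _)).
have hZ i : ext_homog 1 (p [set i] *: ext_gen A i).
  by apply: ext_homogZ; apply: ext_homog_gen.
elim: s => [|i s IHs]; rewrite /x ?big_nil ?mul0r // big_cons -/(x s).
rewrite mulrDl !mulrDr IHs addr0 -scalerAl -scalerAr ext_gen_alternating.1.
rewrite !scaler0 add0r [X in X + _]ext_homog1_anticomm ?addNr //.
exact: ext_homog_sum.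
Qed.

Lemma ext_homog1_alternating k (v : 'I_k -> extalg A m) :
  (forall i, ext_homog 1 (v i)) -> alternating v.
Proof.
by move=> hv; split=> *; [exact: ext_homog1_sqr | exact: ext_homog1_anticomm].
Qed.
End ExtBasis.

(** * Substitutions, contractions and linear independence *)

Section ExtLift.
Variables (A B : comNzRingType) (m k : nat) (f : {rmorphism A -> B}).
Variable v : 'I_m -> extalg B k.
Implicit Types (p q : extalg A m) (I J K : {set 'I_m}).

(** The substitution that applies g to the coefficients and sends the i-th
    generator to v i. The map from the model algebra to forms, the projection
    of forms to h and the linear combinations of products of given one-forms
    are all of this kind. *)
Definition ext_lift (g : A -> B) p : extalg B k :=
  \sum_(I : {set 'I_m}) g (p I) *: \prod_(i in I) v i.

Lemma ext_lift0 : ext_lift f 0 = 0.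
Proof. by rewrite /ext_lift big1 // => I _; rewrite ext0E rmorph0 scale0r. Qed.

Lemma ext_liftD p q : ext_lift f (p + q) = ext_lift f p + ext_lift f q.
Proof.
rewrite /ext_lift -big_split /=; apply: eq_bigr => I _.
by rewrite extDE rmorphD scalerDl.
Qed.

Lemma ext_liftN p : ext_lift f (- p) = - ext_lift f p.
Proof.
by rewrite /ext_lift -sumrN; apply: eq_bigr => I _;
  rewrite extNE rmorphN scaleNr.
Qed.

Lemma ext_liftB p q : ext_lift f (p - q) = ext_lift f p - ext_lift f q.
Proof. by rewrite ext_liftD ext_liftN. Qed.

Lemma ext_lift_sum (T : Type) (r : seq T) (P : pred T) (F : T -> extalg A m) :
  ext_lift f (\sum_(t <- r | P t) F t) = \sum_(t <- r | P t) ext_lift f (F t).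
Proof. exact: (big_morph _ ext_liftD ext_lift0). Qed.

Lemma ext_liftZ c p : ext_lift f (c *: p) = f c *: ext_lift f p.
Proof.
rewrite /ext_lift scaler_sumr; apply: eq_bigr => I _.
by rewrite extZE rmorphM scalerA.
Qed.

Lemma ext_lift_prod I :
  ext_lift f (\prod_(i in I) ext_gen A i) = \prod_(i in I) v i.
Proof.
rewrite /ext_lift (bigD1 I) //= [X in _ + X]big1 => [|J neJ].
  by rewrite prod_ext_genE eqxx rmorph1 scale1r addr0.
by rewrite prod_ext_genE (negPf neJ) rmorph0 scale0r.
Qed.

Lemma ext_lift1 : ext_lift f 1 = 1.
Proof. by have := ext_lift_prod set0; rewrite !big_set0. Qed.

Lemma ext_lift_gen i : ext_lift f (ext_gen A i) = v i.
Proof. by have := ext_lift_prod [set i]; rewrite !big_set1. Qed.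

Hypothesis alt_v : alternating v.

Lemma ext_liftM p q : ext_lift f (p * q) = ext_lift f p * ext_lift f q.
Proof.
rewrite (ext_decomp p) (ext_decomp q) mulr_suml !ext_lift_sum mulr_suml.
apply: eq_bigr => I _; rewrite mulr_sumr !ext_lift_sum mulr_sumr.
apply: eq_bigr => J _; rewrite -scalerAl -scalerAr !ext_liftZ.
rewrite -scalerAl -scalerAr !ext_lift_prod; congr (_ *: (_ *: _)).
rewrite (alt_mul alt_v) (alt_mul (@ext_gen_alternating A m)).
case: ifP => _; last exact: ext_lift0.
by rewrite !ext_sign ext_liftZ ext_lift_prod rmorph_sign.
Qed.

Lemma ext_lift_bigprod (T : Type) (r : seq T) (F : T -> extalg A m) :
  ext_lift f (\prod_(t <- r) F t) = \prod_(t <- r) ext_lift f (F t).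
Proof. exact: (big_morph _ ext_liftM ext_lift1). Qed.
End ExtLift.

Section Contraction.
Variables (A : comNzRingType) (m : nat).
Implicit Types (p q : extalg A m) (I J K : {set 'I_m}) (w : 'I_m -> A).

(** The grading involution, which governs the signs of antiderivations *)
Definition ext_parity p : extalg A m :=
  [ffun I : {set 'I_m} => (-1) ^+ #|I| * p I].

Lemma ext_parityE p I : ext_parity p I = (-1) ^+ #|I| * p I.
Proof. by rewrite ffunE. Qed.

Lemma ext_parityM p q : ext_parity (p * q) = ext_parity p * ext_parity q.
Proof.
apply/ffunP => K; rewrite ext_parityE !extME mulr_sumr.
apply: eq_bigr => I sIK; rewrite !ext_parityE mulrCA; congr (_ * _).
rewrite -(cardsID I K) (setIidPr sIK) exprD.
by rewrite !mulrA; congr (_ * _); rewrite mulrAC.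
Qed.

Lemma ext_parity_homog r p : ext_homog r p -> ext_parity p = (-1) ^+ r *: p.
Proof.
move=> hp; apply/ffunP => I; rewrite ext_parityE extZE.
by have [->|neI] := eqVneq #|I| r; rewrite // hp ?mulr0.
Qed.

Lemma ext_parityD p q : ext_parity (p + q) = ext_parity p + ext_parity q.
Proof. by apply/ffunP => I; rewrite !(ext_parityE, extDE) mulrDr. Qed.

Lemma ext_parityZ c p : ext_parity (c *: p) = c *: ext_parity p.
Proof. by apply/ffunP => I; rewrite !(ext_parityE, extZE) mulrCA. Qed.

Lemma contractionE w p J : contraction w p J =
  \sum_(i | i \notin J)
     (-1) ^+ #|[set j in J | (j < i)%N]| * (w i * p (i |: J)).
Proof. by rewrite ffunE. Qed.

Lemma contractionD w p q :
  contraction w (p + q) = contraction w p + contraction w q.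
Proof.
apply/ffunP => J; rewrite extDE !contractionE -big_split /=;
  apply: eq_bigr => i _.
by rewrite extDE !mulrDr.
Qed.

Lemma contractionZ w c p : contraction w (c *: p) = c *: contraction w p.
Proof.
apply/ffunP => J; rewrite extZE !contractionE mulr_sumr; apply: eq_bigr => i _.
by rewrite extZE !(mulrCA _ c).
Qed.

Lemma contraction0 w : contraction w 0 = 0 :> extalg A m.
Proof.
by apply/ffunP => J; rewrite contractionE [RHS]ext0E big1 // => i _;
  rewrite ext0E !mulr0.
Qed.

Lemma contraction1 w : contraction w 1 = 0.
Proof.
apply/ffunP => J; rewrite ext0E contractionE big1 // => i _; rewrite ext1E.
by rewrite (_ : (_ == _) = false) ?mulr0 //; apply/eqP => /setP/(_ i);
   rewrite !inE eqxx.
Qed.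

Lemma contraction_genM w i q :
  contraction w (ext_gen A i * q) = w i *: q - ext_gen A i * contraction w q.
Proof.
apply/ffunP => J; rewrite extDE extNE extZE ext_genM [LHS]contractionE.
case: ifPn => [iJ|niJ]; last first.
  (* Only the vector component i can remove the new generator. *)
  rewrite subr0 (bigD1 i) //= big1 ?addr0 => [|l /andP[lJ neli]]; last first.
    by rewrite ext_genM !inE eq_sym (negPf neli) (negPf niJ) !mulr0.
  rewrite ext_genM setU11 setU1K // inversions1l.
  by rewrite mulrCA mulr_signK.
(* The component i of the inner contraction cancels w i *: q; for l <> i, the
   signs of crossing l over i and i over l together give -1. *)
rewrite [contraction w q _]contractionE.
rewrite [X in w i * _ - _ * X](bigD1 i) /=; last by rewrite !inE eqxx.
rewrite setD1K // mulrDr opprD.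
rewrite inversions1l mulr_signK.
rewrite addrA subrr add0r -mulrN -sumrN mulr_sumr.
apply: eq_big => l; first by rewrite !inE;
  have [->|_] := eqVneq l i; rewrite ?iJ ?andbF ?andbT.
move=> lJ; have neli : l != i by apply: contraNneq lJ => ->.
rewrite ext_genM !inE iJ orbT.
have -> : (l |: J) :\ i = l |: (J :\ i).
  by apply/setP => x; rewrite !inE; have [->|] //= := eqVneq x l; rewrite ?neli.
have dl (K : {set 'I_m}) : l \notin K -> [disjoint [set l] & K].
  by move=> lK; rewrite disjoints_subset sub1set inE.
have nlJi : l \notin J :\ i by rewrite !inE negb_and lJ orbT.
have dJ : [disjoint [set i] & J :\ i].
  by rewrite disjoints_subset sub1set !inE eqxx.
rewrite inversionsUr ?dl // -!inversions1l -{1}(setD1K iJ) inversionsUr //.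
rewrite !exprD !mulrA -!mulrA.
have : (-1) ^+ inversions [set l] [set i] *
       (-1) ^+ inversions [set i] [set l] = -1 :> A.
  rewrite !inversions1l.
  have E (a b : 'I_m) : #|[set j in [set a] | (j < b)%N]| = (a < b)%N.
    case: ltnP => ab; last first.
      by apply: eq_card0 => x; rewrite !inE; case: eqP => // ->;
        rewrite ltnNge ab.
    by apply: (@eq_card1 _ a) => x; rewrite !inE; case: eqP => // ->;
      rewrite ab.
  rewrite !E; case: ltngtP => [||/val_inj/eqP]; rewrite ?mulr1 ?mul1r //.
  by rewrite eq_sym (negPf neli).
set a := (-1) ^+ inversions [set l] [set i].
set c := (-1) ^+ inversions [set i] [set l] => sg.
set b := (-1) ^+ inversions [set l] (J :\ i).
set d := (-1) ^+ inversions [set i] (J :\ i); set x := q _.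
by transitivity (a * c * (b * (w l * (d * x)))); [ring | rewrite sg; ring].
Qed.

Lemma contractionM w p q :
  contraction w (p * q) = contraction w p * q + ext_parity p * contraction w q.
Proof.
elim/ext_ind: p => [p1 p2 IH1 IH2|c p IH||i p IH].
- by rewrite mulrDl !contractionD IH1 IH2 ext_parityD !mulrDl addrACA.
- by rewrite -scalerAl !contractionZ IH ext_parityZ -!scalerAl scalerDr.
- by rewrite contraction1 mul0r add0r (ext_parity_homog (@ext_homog1 A m))
     scale1r !mul1r.
rewrite -mulrA !contraction_genM IH ext_parityM.
rewrite (ext_parity_homog (ext_homog_gen _ i)) expr1 scaleN1r.
by rewrite mulrDr opprD mulrBl -scalerAl !mulrA !mulNr addrA.
Qed.

Lemma contraction_homog1 w p : ext_homog 1 p ->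
  contraction w p = (\sum_i w i * p [set i])%:A.
Proof.
move=> hp; apply/ffunP => J; rewrite contractionE extZE ext1E.
have [->|neJ] := eqVneq J set0; last first.
  rewrite mulr0 big1 // => i niJ; rewrite hp ?mulr0 // cardsU1 niJ.
  by rewrite -[X in _ != X]addn0 eqn_add2l cards_eq0.
rewrite mulr1; apply: eq_big => i; rewrite !inE // => _; rewrite setU0.
by rewrite (_ : #|_| = 0%N) ?mul1r //; apply: eq_card0 => x; rewrite !inE.
Qed.
End Contraction.

(** A contraction is determined by its Leibniz rule and by its values on
    generators, hence it commutes with any substitution of odd elements for the
    generators that is compatible with these values. *)
Lemma ext_lift_contraction (A B : comNzRingType) (m k : nat)
    (f : {rmorphism A -> B}) (v : 'I_m -> extalg B k)
    (w : 'I_k -> B) (q : 'I_m -> A) :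
  (forall i, ext_homog 1 (v i)) ->
  (forall i, contraction w (v i) = (f (q i))%:A) ->
  forall p, contraction w (ext_lift v f p) = ext_lift v f (contraction q p).
Proof.
move=> hv cv; have alt_v := ext_homog1_alternating hv.
elim/ext_ind => [p1 p2 IH1 IH2|c p IH||i p IH].
- by rewrite ext_liftD !contractionD IH1 IH2 ext_liftD.
- by rewrite ext_liftZ !contractionZ IH ext_liftZ.
- by rewrite ext_lift1 !contraction1 ext_lift0.
rewrite ext_liftM // ext_lift_gen contractionM cv IH contraction_genM.
rewrite (ext_parity_homog (hv i)) expr1 scaleN1r mulNr.
by rewrite ext_liftB ext_liftZ ext_liftM // ext_lift_gen -scalerAl mul1r.
Qed.

Lemma ext_lift_parity (A B : comNzRingType) (m k : nat)
    (f : {rmorphism A -> B}) (v : 'I_m -> extalg B k) :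
  (forall i, ext_homog 1 (v i)) ->
  forall p, ext_parity (ext_lift v f p) = ext_lift v f (ext_parity p).
Proof.
move=> hv; have alt_v := ext_homog1_alternating hv.
elim/ext_ind => [p1 p2 IH1 IH2|c p IH||i p IH].
- by rewrite ext_liftD !ext_parityD IH1 IH2 ext_liftD.
- by rewrite ext_liftZ !ext_parityZ IH ext_liftZ.
- by rewrite ext_lift1 !(ext_parity_homog (@ext_homog1 _ _)) !expr0 !scale1r
  ext_lift1.
rewrite ext_liftM // ext_lift_gen !ext_parityM IH.
rewrite (ext_parity_homog (hv i)) (ext_parity_homog (ext_homog_gen _ i)).
by rewrite !expr1 !scaleN1r !mulNr ext_liftN ext_liftM // ext_lift_gen.
Qed.

Lemma ext_scale_eq0 (A : idomainType) m (c : A) (p : extalg A m) :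
  c *: p = 0 -> c != 0 -> p = 0.
Proof.
move=> cp0 nzc; apply/ffunP => I; have /ffunP/(_ I) := cp0.
by rewrite extZE !ext0E => /eqP; rewrite mulf_eq0 (negPf nzc) => /eqP.
Qed.

(** If the product of all v i is nonzero, so is every v_T * v_(~T), while
    v_S * v_(~T) = 0 as soon as S is not contained in T; so the coefficients
    of a relation vanish one after the other, by increasing cardinality. *)
Lemma ext_lift_inj (A : idomainType) (m k : nat) (v : 'I_m -> extalg A k) :
  alternating v -> \prod_(i < m) v i != 0 ->
  forall p, ext_lift v idfun p = 0 -> p = 0.
Proof.
move=> alt_v nz_v p p0; apply/ffunP => T; rewrite ext0E.
have [n leTn] := ubnP #|T|; elim: n => // n IHn in T leTn *.
have := congr1 (fun x => x * \prod_(i in ~: T) v i) p0.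
rewrite mul0r mulr_suml (bigD1 T) //= [X in _ + X]big1 => [|S neST].
  rewrite addr0 -scalerAl alt_mul // disjoints_subset setCK subxx setUCr.
  rewrite ext_sign scalerA => /ext_scale_eq0 h; apply/eqP.
  apply: contraNT nz_v => nzT.
  by rewrite -(h _) ?mulf_neq0 ?signr_eq0 //; apply/eqP; apply: eq_bigl => i;
     rewrite inE.
rewrite -scalerAl alt_mul // disjoints_subset setCK.
have [sST|] := boolP (S \subset T); last by rewrite scaler0.
rewrite IHn ?scale0r // -ltnS; apply: leq_trans leTn.
by rewrite ltnS proper_card // properEneq neST.
Qed.

(** * Newton's identities *)

Lemma mderivXU (R : nzRingType) n (i j : 'I_n) :
  ('X_j : {mpoly R[n]})^`M(i) = (i == j)%:R.
Proof.
rewrite mderivX mnm1E eq_sym; have [->|_] := eqVneq j i; last exact: scale0r.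
have -> : (U_(i) - U_(i) = 0 :> 'X_{1..n})%MM.
  by apply/mnmP => l; rewrite !mnmE subnn.
by rewrite mpolyX0 scale1r.
Qed.

Section ElementarySymmetric.
Variables (F : fieldType) (n : nat).
Local Notation e := (mesym n F).

Lemma mesym1D1 (h : {set 'I_n}) i : i \in h ->
  (mesym1 h = mesym1 (h :\ i) + U_(i))%MM.
Proof.
move=> ih; apply/mnmP => j; rewrite mnmDE mnm1E !mnmE !inE.
by have [->|neji] := eqVneq j i;
  rewrite ?ih ?eqxx ?(eq_sym i) ?(negPf neji) ?addn0.
Qed.

Lemma mderiv_mesym1 (h : {set 'I_n}) i :
  ('X_[mesym1 h] : {mpoly F[n]})^`M(i) =
  if i \in h then 'X_[mesym1 (h :\ i)] else 0.
Proof.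
rewrite mderivX mnmE; case: ifP => ih; last by rewrite scale0r.
by rewrite scale1r (mesym1D1 ih) addmK.
Qed.

(** The derivative of e_(k+1) is e_k of the other variables, and e_k is the sum
    of its monomials without x_i and with x_i. *)
Lemma mderiv_mesym k (i : 'I_n) :
  (e k.+1)^`M(i) + 'X_i * (e k)^`M(i) = e k.
Proof.
rewrite !mesymE !raddf_sum /= mulr_sumr.
rewrite addrC [RHS](bigID (fun h : {set 'I_n} => i \in h)) /=; congr (_ + _).
  rewrite [RHS]big_mkcondr; apply: eq_bigr => h _; rewrite mderiv_mesym1.
  by case: ifP => ih; rewrite ?mulr0 // [in RHS](mesym1D1 ih) mpolyXD mulrC.
rewrite (bigID (fun h : {set 'I_n} => i \in h)) /= addrC big1 ?add0r;
  last first.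
  by move=> h /andP[_ /negPf ih]; rewrite mderiv_mesym1 ih.
rewrite (reindex_onto (fun h => i |: h) (fun h => h :\ i)) /=; last first.
  by move=> h /andP[_ ih]; rewrite setD1K.
apply: eq_big => h; last by move=> /andP[_ /eqP eh];
  rewrite mderiv_mesym1 setU11 eh.
rewrite setU11 andbT cardsU1; case: (boolP (i \in h)) => ih /=.
  rewrite andbF; apply/andP => -[_ /eqP /setP/(_ i)].
  by rewrite !inE eqxx ih.
by rewrite setU1K // eqxx !andbT add1n eqSS.
Qed.

Lemma euler_mesym k : \sum_(i < n) 'X_i * (e k)^`M(i) = k%:R *: e k.
Proof.
rewrite mesymE scaler_sumr.
under eq_bigr do rewrite raddf_sum mulr_sumr /=.
rewrite exchange_big /=; apply: eq_bigr => h /eqP <-.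
rewrite -sum1_card natr_sum scaler_suml [RHS]big_mkcond /=.
apply: eq_bigr => i _; rewrite mderiv_mesym1; case: ifP => ih;
  last exact: mulr0.
by rewrite (mesym1D1 ih) mpolyXD scale1r mulrC.
Qed.

Lemma mderiv_mesymE k (i : 'I_n) :
  (e k.+1)^`M(i) = \sum_(l < k.+1) (- 'X_i) ^+ l * e (k - l).
Proof.
elim: k => [|k IHk].
  have := mderiv_mesym 0 i; rewrite big_ord1 mesym0E mul1r -mpolyC1 mderivC.
  by rewrite mulr0 addr0.
have /eqP := mderiv_mesym k.+1 i; rewrite eq_sym -subr_eq => /eqP <-.
rewrite big_ord_recl mul1r subn0 IHk -mulNr mulr_sumr; congr (_ + _).
by apply: eq_bigr => l _; rewrite mulrA -exprS.
Qed.

(** Euler's identity for e_(k+1), with its derivatives expanded by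
    mderiv_mesymE. *)
Lemma newton_mesym k :
  k.+1%:R *: e k.+1 =
  \sum_(l < k.+1) (-1) ^+ l * powsum F n l.+1 * e (k - l).
Proof.
rewrite -euler_mesym; under eq_bigr do rewrite mderiv_mesymE mulr_sumr.
rewrite exchange_big /=; apply: eq_bigr => l _.
rewrite mulrAC mulr_sumr; apply: eq_bigr => i _.
by rewrite (exprNn 'X_i) exprS; ring.
Qed.
End ElementarySymmetric.

Lemma comp_mpolyA (F : fieldType) k n r (p : {mpoly F[k]})
    (t : k.-tuple {mpoly F[n]}) (s : n.-tuple {mpoly F[r]}) :
  (p \mPo t) \mPo s = p \mPo [tuple tnth t i \mPo s | i < k].
Proof.
rewrite [p \mPo t]comp_mpolyE [RHS]comp_mpolyE raddf_sum /=.
apply: eq_bigr => m _; rewrite comp_mpolyZ rmorph_prod /=; congr (_ *: _).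
by apply: eq_bigr => i _; rewrite rmorphXn /= tnth_mktuple.
Qed.

Section FormalNewton.
Variable F : fieldType.

(** The polynomial expressing p_k by elementary symmetric functions, evaluated
    at an arbitrary sequence c in place of the latter. *)
Definition powsum_at n (c : nat -> {mpoly F[n]}) k : {mpoly F[n]} :=
  powsum_elem F k \mPo [tuple c i.+1 | i < k].

Lemma powsum_at_mesym n : powsum_at (mesym n F) n = powsum F n n.
Proof.
by rewrite /powsum_at /powsum_elem; case: sym_fundamental_homog => t [].
Qed.

Lemma powsum_at_ext n (c d : nat -> {mpoly F[n]}) k :
  (forall j, (0 < j <= k)%N -> c j = d j) -> powsum_at c k = powsum_at d k.
Proof.
move=> cd; rewrite /powsum_at; congr (_ \mPo _); apply: eq_from_tnth => i.
by rewrite !tnth_mktuple cd // ltn_ord.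
Qed.

Lemma powsum_at_comp n r (c : nat -> {mpoly F[n]})
    (s : n.-tuple {mpoly F[r]}) k :
  powsum_at c k \mPo s = powsum_at (fun j => c j \mPo s) k.
Proof.
rewrite /powsum_at comp_mpolyA; congr (_ \mPo _); apply: eq_from_tnth => i.
by rewrite !tnth_mktuple.
Qed.

Let newton_at k := forall n (c : nat -> {mpoly F[n]}), c 0%N = 1 ->
  k.+1%:R *: c k.+1 =
  \sum_(l < k.+1) (-1) ^+ l * powsum_at c l.+1 * c (k - l)%N.

(* Both sides satisfy Newton's recursion with the same e_j, so the formula for
   p_(l+1), found in l+1 variables, holds in any number of variables. *)
Let stable k n : (forall l, (l < k)%N -> newton_at l) ->
  forall l, (l < k)%N -> powsum_at (mesym n F) l.+1 = powsum F n l.+1.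
Proof.
move=> Nk l; have [r] := ubnP l; elim: r => // r IHr in l *.
rewrite ltnS => ler ltl.
have := Nk _ ltl n (mesym n F) (mesym0E _ _); rewrite newton_mesym.
rewrite !big_ord_recr /= subnn mesym0E !mulr1.
rewrite (eq_bigr (fun j : 'I_l =>
   (-1) ^+ j * powsum_at (mesym n F) j.+1 * mesym n F (l - j))); last first.
  by move=> j _; rewrite IHr // (leq_trans (ltn_ord j)) // ltnW.
move/addrI/(congr1 (fun x => (-1) ^+ l * x)).
by rewrite !mulr_signK.
Qed.

(** Newton's identities are identities between polynomials in the e_i, since
    the elementary symmetric polynomials are algebraically independent. *)
Lemma newton_powsum_at k : newton_at k.
Proof.
have [r] := ubnP k; elim: r => // r IHr in k *; rewrite ltnS => lekr n c c0.
have Nk l : (l < k)%N -> newton_at l.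
  by move=> ltlk; apply: IHr; apply: leq_trans lekr.
(* The generic sequence: Y 0 = 1 followed by indeterminates. *)
pose Y j : {mpoly F[k.+1]} := if j is i.+1 then 'X_(inord i) else 1.
have YE n' (d : nat -> {mpoly F[n']}) : d 0%N = 1 -> forall j, (j <= k.+1)%N ->
    Y j \mPo [tuple d i.+1 | i < k.+1] = d j.
  move=> d0 [_|j ltjk]; first by rewrite comp_mpoly1 d0.
  by rewrite comp_mpolyXU -tnth_nth tnth_mktuple inordK.
have polyE : k.+1%:R *: Y k.+1 =
    \sum_(l < k.+1) (-1) ^+ l * powsum_at Y l.+1 * Y (k - l)%N.
  apply: (@msym_fundamental_un k.+1 F); rewrite comp_mpolyZ YE ?mesym0E //.
  rewrite newton_mesym raddf_sum /=; apply: eq_bigr => l _.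
  rewrite !rmorphM /= rmorph_sign YE ?mesym0E //; last first.
    by rewrite (leq_trans (leq_subr _ _)).
  congr (_ * _ * _); rewrite powsum_at_comp.
  rewrite (@powsum_at_ext _ _ (mesym k.+1 F)); last first.
    move=> j /andP[_ lejl]; rewrite YE ?mesym0E //.
    by rewrite (leq_trans lejl).
  have [->|neqlk] := eqVneq (l : nat) k; first by rewrite powsum_at_mesym.
  by rewrite (stable _ Nk) // ltn_neqAle neqlk -ltnS ltn_ord.
have := congr1 (comp_mpoly [tuple c i.+1 | i < k.+1]) polyE.
rewrite comp_mpolyZ YE // => ->; rewrite raddf_sum /=; apply: eq_bigr => l _.
rewrite !rmorphM /= rmorph_sign YE //;
  last by rewrite (leq_trans (leq_subr _ _)).
congr (_ * _ * _); rewrite powsum_at_comp;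
  apply: powsum_at_ext => j /andP[_ lej].
by rewrite YE // (leq_trans lej).
Qed.
End FormalNewton.

Section NormalisedPowerSums.
Variables (F : fieldType) (n : nat).

(** The normalised elementary symmetric functions; the u_k are obtained from
    them as the power sums are obtained from the e_k. *)
Definition nmesym j : {mpoly F[n]} := ((n - j)`!%:R / n`!%:R) *: mesym n F j.

Lemma u_powsum_at k : u F n k = powsum_at nmesym k.+1.
Proof.
rewrite /powsum_at; set t := [tuple _ | i < _].
have homW : powsum_elem F k.+1 \is k.+1.-homog for mnmwgt.
  by rewrite /powsum_elem; case: sym_fundamental_homog => ? [].
have szt : (msize (powsum_elem F k.+1) <= k.+2)%N.
  rewrite msizeE; apply/bigmax_leqP_seq => lam lam_t _.
  have := leq_mdeg_mnmwgt lam.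
  by rewrite (dhomogP _ _ _ homW lam lam_t) ltnS.
rewrite (comp_mpolywE _ szt) (bigID (fun lam => mnmwgt (bmnm lam) == k.+1)) /=.
rewrite [X in _ = _ + X]big1 ?addr0 => [|lam /(dhomog_nemf_coeff homW) ->];
  last first.
  by rewrite scale0r.
apply: eq_bigr => lam _; rewrite -scalerA; congr (_ *: _).
rewrite /elem_part -scaler_prod; apply: eq_bigr => i _.
by rewrite tnth_mktuple exprZn.
Qed.
End NormalisedPowerSums.

(** * Derivations of the normalised elementary symmetric functions *)

Section Convolution.
Variable A : comNzRingType.
Implicit Types f g h : nat -> A.

(** Coefficients of a product of power series *)
Definition conv f g k : A := \sum_(i < k.+1) f i * g (k - i)%N.

(* Truncations reduce the laws of conv to those of polynomials. *)
Let trunc k f : {poly A} := \poly_(i < k.+1) f i.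

Let coef_trunc k f i : (i <= k)%N -> (trunc k f)`_i = f i.
Proof. by move=> leik; rewrite coef_poly ltnS leik. Qed.

Let coef_truncM k f g l : (l <= k)%N -> (trunc k f * trunc k g)`_l = conv f g l.
Proof.
move=> lelk; rewrite coefM; apply: eq_bigr => i _.
have leil : (i <= l)%N by rewrite -ltnS.
by rewrite !coef_trunc ?(leq_trans leil) // (leq_trans (leq_subr i l)).
Qed.

Lemma convC f g k : conv f g k = conv g f k.
Proof. by rewrite -!(coef_truncM _ _ (leqnn k)) mulrC. Qed.

Lemma convCA f g h k : conv f (conv g h) k = conv g (conv f h) k.
Proof.
have E x y z : conv x (conv y z) k = (trunc k x * (trunc k y * trunc k z))`_k.
  rewrite coefM; apply: eq_bigr => i _.
  by rewrite coef_trunc ?leq_ord // coef_truncM ?leq_subr.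
by rewrite !E mulrCA.
Qed.

Lemma eq_conv f f' g g' k : (forall i, (i <= k)%N -> f i = f' i) ->
  (forall i, (i <= k)%N -> g i = g' i) -> conv f g k = conv f' g' k.
Proof.
move=> ef eg; apply: eq_bigr => i _; rewrite ef ?eg ?leq_subr //.
by rewrite -ltnS.
Qed.

(** A power series with constant term 1 is invertible, and its inverse does not
    involve coefficients of higher degree. *)
Lemma conv_inj f f' g n : g 0%N = 1 ->
  (forall k, (k < n)%N -> conv f g k = conv f' g k) ->
  forall k, (k < n)%N -> f k = f' k.
Proof.
move=> g0 ec k; have [r] := ubnP k; elim: r => // r IHr in k *;
  rewrite ltnS => lekr ltkn.
have := ec k ltkn; rewrite /conv !big_ord_recr /= subnn g0 !mulr1.
rewrite (eq_bigr (fun i : 'I_k => f' i * g (k - i)%N)) => [/addrI//|i _].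
by rewrite IHr // ?(leq_trans (ltn_ord i)) // ltnW // (leq_trans _ ltkn) // ltnS
  ltnW.
Qed.
End Convolution.

Section NormalisedElementary.
Variables (F : numFieldType) (n : nat).
Local Notation P := {mpoly F[n]}.
Local Notation e := (mesym n F).
Local Notation eh := (nmesym F n).
Local Notation u := (u F n).

Let fact_neq0 k : k`!%:R != 0 :> F.
Proof. by rewrite pnatr_eq0 -lt0n fact_gt0. Qed.

Lemma nmesym0 : eh 0%N = 1.
Proof. by rewrite /nmesym subn0 divff // scale1r mesym0E. Qed.

(* For k = n both sides vanish, because e_(n+1) = 0. *)
Lemma nmesym_mesymS k : (k <= n)%N ->
  ((n - k)`!%:R / n`!%:R : F) *: e k.+1 = (n - k)%:R *: eh k.+1.
Proof.
rewrite leq_eqVlt => /predU1P[->|ltkn].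
  by rewrite mesym_geqnE // subnn scaler0 scale0r.
rewrite /nmesym scalerA mulrA -natrM; congr (_%:R / _ *: _).
by rewrite -subSS (subSn ltkn) factS.
Qed.

Definition usgn k : P := (-1) ^+ k * u k.

Lemma newton_nmesym k : k.+1%:R *: eh k.+1 = conv usgn eh k.
Proof.
rewrite (newton_powsum_at k nmesym0); apply: eq_bigr => l _.
by rewrite /usgn u_powsum_at.
Qed.

Lemma u0E : u 0%N = eh 1%N.
Proof.
have := newton_nmesym 0; rewrite scale1r => ->.
by rewrite /conv big_ord1 /usgn nmesym0 mulr1 mul1r.
Qed.

Section Derivation.
(* The components of a vector field *)
Variable w : 'I_n -> P.

Definition vder (p : P) : P := \sum_(i < n) w i * p^`M(i).

Lemma vderZ c p : vder (c *: p) = c *: vder p.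
Proof.
rewrite /vder scaler_sumr; apply: eq_bigr => i _.
by rewrite mderivZ scalerAr.
Qed.

Lemma vderM p q : vder (p * q) = vder p * q + p * vder q.
Proof.
rewrite /vder mulr_suml mulr_sumr -big_split; apply: eq_bigr => i _ /=.
by rewrite mderivM; ring.
Qed.

Lemma vder_sum (I : Type) (r : seq I) (f : I -> P) :
  vder (\sum_(i <- r) f i) = \sum_(i <- r) vder (f i).
Proof.
rewrite /vder exchange_big /=; apply: eq_bigr => i _.
by rewrite raddf_sum mulr_sumr.
Qed.

Lemma vder1 : vder 1 = 0.
Proof. by rewrite /vder big1 // => i _; rewrite -mpolyC1 mderivC mulr0. Qed.

Definition vder_coef k : P := k.+1%:R^-1 *: vder (u k).
Definition vder_coefs k : P := (-1) ^+ k * vder_coef k.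

(** With Eh(t) the generating series of the normalised e_k, Newton's identities
    say that u is the logarithmic derivative of Eh up to signs, so that a
    derivation multiplies Eh by the series of the vder u_k / (k+1). *)
Lemma vder_nmesym k : vder (eh k.+1) = conv vder_coefs eh k.
Proof.
have [r] := ubnP k; elim: r => // r IHr in k *; rewrite ltnS => lekr.
have nz : k.+1%:R != 0 :> F by rewrite pnatr_eq0.
apply: (scalerI nz); rewrite -vderZ newton_nmesym /conv vder_sum scaler_sumr.
under eq_bigr do rewrite vderM.
rewrite big_split /= [X in _ + X]big_ord_recr /= subnn nmesym0 vder1 mulr0
  addr0.
have -> : \sum_(i < k) usgn i * vder (eh (k - i)%N) =
          \sum_(i < k) vder_coefs i * ((k - i)%:R *: eh (k - i)%N).
  case: k lekr {nz} => [|k] lekr; first by rewrite !big_ord0.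
  transitivity (conv usgn (conv vder_coefs eh) k).
    apply: eq_bigr => i _; rewrite subSn ?leq_ord // IHr //.
    by rewrite (leq_trans _ lekr) // ltnS leq_subr.
  rewrite convCA; apply: eq_bigr => i _.
  by rewrite subSn ?leq_ord // newton_nmesym.
have -> : \sum_(i < k) vder_coefs i * ((k - i)%:R *: eh (k - i)%N) =
          \sum_(i < k.+1) vder_coefs i * ((k - i)%:R *: eh (k - i)%N).
  by rewrite big_ord_recr /= subnn scale0r mulr0 addr0.
rewrite -big_split; apply: eq_bigr => i _ /=.
rewrite /vder_coefs /usgn vderM; move: (eh (k - i)%N) => x.
have -> : vder ((-1) ^+ i) = 0.
  by rewrite -signr_odd; case: odd; rewrite /= ?expr0 ?expr1 ?vder1 // -scaleN1r
    vderZ vder1 scaler0.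
rewrite mul0r add0r.
have -> : vder (u i) = i.+1%:R *: vder_coef i.
  by rewrite /vder_coef scalerA divff ?pnatr_eq0 // scale1r.
rewrite -!scalerAr -scalerAl -scalerDl -natrD; congr (_%:R *: _).
by rewrite addSn subnKC // -ltnS.
Qed.
End Derivation.
End NormalisedElementary.

(** * The contractions of the xi_k: a recursion on N *)

Section Recursion.
Variables (F : numFieldType) (n : nat).
Hypothesis n_gt0 : (0 < n)%N.
Local Notation P := {mpoly F[n]}.
Local Notation e := (mesym n F).
Local Notation eh := (nmesym F n).
Local Notation u := (u F n).

Definition xpow N (i : 'I_n) : P := xtilde F i ^+ N.
Definition xpowsum N : P := \sum_(i < n) xpow N i.
(** The contraction of xi_k with the vector field sum_i xtilde_i^N e_i *)
Definition qcoef N k : P := vder_coef (xpow N) k.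

Let xbar : P := (n%:R^-1 : F) *: \sum_(j < n) 'X_j.

Let n_neq0 : n%:R != 0 :> F. Proof. by rewrite pnatr_eq0 -lt0n. Qed.

Let fact_neq0 k : k`!%:R != 0 :> F.
Proof. by rewrite pnatr_eq0 -lt0n fact_gt0. Qed.

Let nmesym1E : eh 1%N = xbar.
Proof.
rewrite /nmesym mesym1E /xbar; congr (_ *: _).
rewrite -[in n`!](prednK n_gt0) factS prednK // subn1 natrM invfM mulrCA divff
  //.
by rewrite mulr1.
Qed.

Lemma xpowsumE N : xpowsum N = n%:R *: qcoef N 0.
Proof.
rewrite /qcoef /vder_coef invr1 scale1r u0E nmesym1E vderZ scalerA divff //
  scale1r.
apply: eq_bigr => i _; rewrite raddf_sum /= (bigD1 i) //= big1 => [|j neji].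
  by rewrite mderivXU eqxx addr0 mulr1.
by rewrite mderivXU eq_sym (negPf neji).
Qed.

Let step_mesym N k :
  vder (xpow N) (e k.+1) + vder (xpow N.+1) (e k) + xbar * vder (xpow N) (e k) =
  xpowsum N * e k.
Proof.
rewrite /vder /xpowsum mulr_suml mulr_sumr -!big_split;
  apply: eq_bigr => i _ /=.
rewrite -[in RHS](mderiv_mesym F k i) /xpow exprS.
have -> : 'X_i = xtilde F i + xbar by rewrite /xtilde -/xbar subrK.
ring.
Qed.

Let step_nmesym N k : (k <= n)%N ->
  vder (xpow N.+1) (eh k) = xpowsum N * eh k - xbar * vder (xpow N) (eh k)
    - (n - k)%:R *: vder (xpow N) (eh k.+1).
Proof.
move=> lekn; rewrite -[_ *:
  vder _ (eh k.+1)]vderZ -nmesym_mesymS // /nmesym !vderZ.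
rewrite -!scalerAr -!scalerBr -step_mesym; congr (_ *: _); ring.
Qed.

(** For N = 0 the vector field is the derivative along (1, ..., 1), which maps
    the k-th normalised e_k to the preceding one: the generating series gets
    multiplied by t. *)
Lemma qcoef0 k : (k < n)%N -> qcoef 0 k = (k == 0%N)%:R.
Proof.
have sgn : forall j, (j < n)%N -> vder_coefs (xpow 0) j = (j == 0%N)%:R.
  apply: (conv_inj (nmesym0 F n)) => j ltjn.
  rewrite -vder_nmesym /conv big_ord_recl mul1r subn0 [X in _ + X]big1 ?addr0;
    last first.
    by move=> i _; rewrite mul0r.
  have D : vder (xpow 0) (e j.+1) = (n - j)%:R *: e j.
    have : vder (xpow 0) (e j.+1) + j%:R *: e j = n%:R *: e j.
      transitivity (\sum_(i < n) e j);
        last by rewrite sumr_const card_ord scaler_nat.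
      rewrite -euler_mesym /vder -big_split; apply: eq_bigr => i _ /=.
      by rewrite mul1r mderiv_mesym.
    by move/(canRL (addrK _)) => ->; rewrite -scalerBl natrB // ltnW.
  rewrite /nmesym vderZ D scalerA -mulrA [_^-1 * _]mulrC mulrA -natrM.
  by rewrite -(subSS j n) (subSn ltjn) factS mulnC.
move=> ltkn; have := sgn _ ltkn; rewrite /vder_coefs -/(qcoef 0 k).
move/(congr1 (fun x => (-1) ^+ k * x)); rewrite mulr_signK => ->.
by case: k {ltkn} => [|k]; rewrite ?mulr0 ?mul1r.
Qed.

(** The coefficients of the series u, which has no constant term; u_0 = e_1 / n
    is not one of the generators. *)
Definition u_pos k : P := if k is 0%N then 0 else u k.

(** Let D_N be the derivation of the vector field and Eh the generating series
    of the normalised e_k. By vder_nmesym, D_N Eh = Eh * A_N where A_N has the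
    coefficients (-1)^k q_(N,k) t^(k+1), and step_nmesym relates D_(N+1) Eh to
    D_N Eh and its derivative in t. Dividing by Eh, whose logarithmic derivative
    is the signed series of the u_k, turns this relation into a recursion for
    A_N: the product with u comes from the derivative of Eh, the second summand
    from the derivative of A_N. The mean u_0 drops out as xtilde_i = x_i - u_0. *)
Lemma qcoefS N k : (k < n)%N ->
  qcoef N.+1 k = conv u_pos (qcoef N) k + (n - k.+1)%:R *: qcoef N k.+1.
Proof.
pose a := vder_coefs (xpow N).
pose b i : P := (-1) ^+ i * u_pos i.
have bE m : conv b eh m = m.+1%:R *: eh m.+1 - xbar * eh m.
  rewrite newton_nmesym /conv !big_ord_recl /b !mulr0 mul0r add0r subn0.
  by rewrite [usgn _ _ _]/usgn mul1r u0E nmesym1E addrC addKr.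
suff sgn : forall j, (j < n)%N -> vder_coefs (xpow N.+1) j =
    conv b a j - (n - j.+1)%:R *: a j.+1.
  move=> ltkn; have := sgn _ ltkn; rewrite /vder_coefs -/(qcoef N.+1 k).
  move/(congr1 (fun x => (-1) ^+ k * x)); rewrite mulr_signK => ->.
  have -> : a k.+1 = - ((-1) ^+ k * qcoef N k.+1).
    by rewrite /a /vder_coefs exprS mulN1r mulNr.
  rewrite scalerN opprK mulrDr -scalerAr mulr_signK; congr (_ + _).
  rewrite /conv mulr_sumr; apply: eq_bigr => i _.
  rewrite /b -/(qcoef N (k - i)) mulrACA -exprD subnKC ?leq_ord //.
  by rewrite mulr_signK.
apply: (conv_inj (nmesym0 F n)) => j ltjn.
rewrite -vder_nmesym step_nmesym // xpowsumE !vder_nmesym -/a.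
(* All the terms that are not products with b are weighted versions of the
   convolution of a and eh in degree j + 1. *)
pose S c := \sum_(m < j.+2) (c m)%:R *: (a m * eh (j.+1 - m)%N).
have a0 : a 0%N = qcoef N 0 by rewrite /a /vder_coefs mul1r.
have -> : conv (fun j => conv b a j - (n - j.+1)%:R *: a j.+1) eh j =
          conv a (conv b eh) j - (S (fun m =>
            n - m)%N - n%:R *: (a 0%N * eh j.+1)).
  rewrite /S big_ord_recl subn0 addrAC subrr add0r /=.
  transitivity (conv (conv b a) eh j - \sum_(i < j.+1)
     (n - i.+1)%:R *: (a i.+1 * eh (j - i)%N)).
    rewrite -sumrB; apply: eq_bigr => i _.
    by rewrite mulrBl -scalerAl.
  congr (_ - _); rewrite convC convCA; rewrite [RHS]convCA.
  by apply: eq_conv => // i _; rewrite convC.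
have -> : conv a (conv b eh) j = S (fun m => j.+1 - m)%N - xbar * conv a eh j.
  rewrite /S big_ord_recr /= subnn scale0r addr0 /conv mulr_sumr -sumrB.
  apply: eq_bigr => i _; rewrite -/(conv b eh _) bE mulrBr -scalerAr -subSn
    ?leq_ord //.
  by rewrite [a i * (xbar * _)]mulrCA.
have -> : (n - j.+1)%:R *: conv a eh j.+1 = S (fun m => n - m)%N - S (fun m =>
  j.+1 - m)%N.
  rewrite /S -sumrB /conv scaler_sumr; apply: eq_bigr => m _.
  rewrite -scalerBl -natrB; last by rewrite leq_sub2r.
  by rewrite subnBA ?leq_ord // subnK ?(leq_trans _ ltjn) // -ltnS.
rewrite a0 -scalerAl; ring.
Qed.
End Recursion.

(** * Independence of the u_k and of the xi_k *)

Section Differentials.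
Variables (F : fieldType) (n : nat).
Local Notation P := {mpoly F[n]}.

(** The exterior derivative of a polynomial *)
Definition dform (p : P) : pform F n := \sum_(i < n) p^`M(i) *: dx F i.

Lemma dformE p (J : {set 'I_n}) :
  dform p J = \sum_(i < n) p^`M(i) * (J == [set i])%:R.
Proof. by rewrite ext_sumE; apply: eq_bigr => i _; rewrite extZE ffunE. Qed.

Lemma dform_set1 p i : dform p [set i] = p^`M(i).
Proof.
rewrite dformE (bigD1 i) //= eqxx mulr1 big1 ?addr0 // => j neji.
by rewrite (inj_eq set1_inj) eq_sym (negPf neji) mulr0.
Qed.

Lemma dform_homog p : ext_homog 1 (dform p).
Proof. by apply: ext_homog_sum => i _; apply: ext_homogZ;
  apply: ext_homog_gen. Qed.

Lemma dformD p q : dform (p + q) = dform p + dform q.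
Proof.
by rewrite /dform -big_split; apply: eq_bigr => i _; rewrite mderivD scalerDl.
Qed.

Lemma dformM p q : dform (p * q) = q *: dform p + p *: dform q.
Proof.
rewrite /dform !scaler_sumr -big_split; apply: eq_bigr => i _ /=.
by rewrite mderivM scalerDl !scalerA [q * _]mulrC.
Qed.

Lemma dformC c : dform c%:MP = 0.
Proof. by rewrite /dform big1 // => i _; rewrite mderivC scale0r. Qed.

Lemma dformZ c p : dform (c *: p) = c%:MP *: dform p.
Proof. by rewrite -mul_mpolyC dformM dformC scaler0 add0r. Qed.

Lemma dform_comp k (g : {mpoly F[k]}) (t : k.-tuple P) :
  dform (g \mPo t) = \sum_(l < k) (g^`M(l) \mPo t) *: dform (tnth t l).
Proof.
pose good g := dform (g \mPo t) = \sum_(l < k) (g^`M(l) \mPo t) *: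
  dform (tnth t l).
have gM p q : good p -> good q -> good (p * q).
  rewrite /good rmorphM /= dformM => -> ->; rewrite !scaler_sumr -big_split.
  apply: eq_bigr => l _ /=.
  by rewrite mderivM rmorphD !rmorphM /= scalerDl !scalerA [_ * (q \mPo
    t)]mulrC.
have gC c : good c%:MP.
  rewrite /good comp_mpolyC dformC big1 // => l _.
  by rewrite mderivC comp_mpoly0 scale0r.
have gX i : good 'X_i.
  rewrite /good comp_mpolyXU -tnth_nth (bigD1 i) //= big1 => [|l neli].
    by rewrite mderivXU eqxx comp_mpoly1 scale1r addr0.
  by rewrite mderivXU (negPf neli) comp_mpoly0 scale0r.
have gX' m : good 'X_[m].
  rewrite mpolyXE_id; apply: (big_ind good) => [|p q|i _]; first exact: (gC 1).
    exact: gM.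
  elim: (m i) => [|r IHr]; first exact: (gC 1).
  by rewrite exprS; apply: gM.
rewrite -/(good g) [g]mpolyE; apply: (big_ind good) => [|p q gp gq|m _].
- by rewrite -mpolyC0; apply: gC.
- rewrite /good raddfD /= dformD gp gq -big_split; apply: eq_bigr => l _ /=.
  by rewrite mderivD raddfD scalerDl.
- by rewrite -mul_mpolyC; apply: gM.
Qed.
End Differentials.

Section XiForms.
Variables (F : numFieldType) (n : nat).
Local Notation P := {mpoly F[n]}.
Local Notation e := (mesym n F).
Local Notation eh := (nmesym F n).
Local Notation u := (u F n).
Local Notation xi := (xi F n).

Lemma xi_dform k : xi k = (k.+1%:R^-1)%:MP *: dform (u k).
Proof.
rewrite /xi /dform scaler_sumr; apply: eq_bigr => i _.
by rewrite scalerA mul_mpolyC.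
Qed.

Lemma dform_u k : dform (u k) = k.+1%:R *: xi k.
Proof.
rewrite xi_dform scalerA -mpolyC_nat -mpolyCM divff ?pnatr_eq0 //.
by rewrite scale1r.
Qed.

Lemma xi_homog k : ext_homog 1 (xi k).
Proof. by rewrite xi_dform; apply: ext_homogZ; apply: dform_homog. Qed.

Lemma xi_set1 k i : xi k [set i] = k.+1%:R^-1 *: (u k)^`M(i).
Proof. by rewrite xi_dform extZE dform_set1 mul_mpolyC. Qed.

Lemma dform_nmesym k :
  dform (eh k.+1) = \sum_(l < k.+1) ((-1) ^+ l * eh (k - l)%N) *: xi l.
Proof.
apply/ffunP => J; rewrite [RHS]ext_sumE.
have [/cards1P[i ->]|neJ] := boolP (#|J| == 1%N); last first.
  rewrite (dform_homog _ neJ) big1 // => l _.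
  by rewrite extZE (xi_homog _ neJ) mulr0.
pose w j : P := (j == i)%:R.
have wE p : vder w p = p^`M(i).
  rewrite /vder (bigD1 i) //= big1 /w ?eqxx ?mul1r ?addr0 // => j /negPf->.
  by rewrite mul0r.
rewrite dform_set1 -wE vder_nmesym; apply: eq_bigr => l _.
by rewrite extZE xi_set1 /vder_coefs /vder_coef wE; ring.
Qed.

(* The one-forms that are combinations of xi_0, ..., xi_(n-1) *)
Let span (p : pform F n) := exists2 b : extalg P n,
  ext_homog 1 b & ext_lift (fun k : 'I_n => xi k) idfun b = p.

Let span_sum T (r : seq T) (f : T -> pform F n) :
  (forall t, span (f t)) -> span (\sum_(t <- r) f t).
Proof.
move=> sf; apply: (big_ind span) => [|p q [a ha <-] [b hb <-]|t _].
  by exists 0; [move=> I _; rewrite ext0E | rewrite (ext_lift0 idfun)].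
  by exists (a + b); [apply: ext_homogD | rewrite (ext_liftD idfun)].
exact: sf.
Qed.

Let spanZ c p : span p -> span (c *: p).
Proof.
by move=> [a ha <-]; exists (c *: a);
  [apply: ext_homogZ | rewrite (ext_liftZ idfun)].
Qed.

Let span_xi k : (k < n)%N -> span (xi k).
Proof.
move=> ltkn; exists (ext_gen _ (Ordinal ltkn)); first exact: ext_homog_gen.
by rewrite (ext_lift_gen idfun).
Qed.

Let span_mesym k : (k < n)%N -> span (dform (e k.+1)).
Proof.
move=> ltkn; have nz : (n - k.+1)`!%:R / n`!%:R != 0 :> F.
  by rewrite mulf_neq0 ?invr_eq0 // pnatr_eq0 -lt0n fact_gt0.
have -> : e k.+1 = ((n - k.+1)`!%:R / n`!%:R)^-1 *: eh k.+1.
  by rewrite scalerA mulVf // scale1r.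
rewrite dformZ; apply: spanZ; rewrite dform_nmesym; apply: span_sum => l.
by apply: spanZ; apply: span_xi; rewrite (leq_trans (ltn_ord l)).
Qed.

(* Let P(z) = prod_j (z + x_j). The one-form dP at z = -x_i has only the
   component dx_i, with the following coefficient, which is P'(-x_i). *)
Let lagr i : P := \sum_(j < n) (- 'X_i) ^+ (n - j.+1) * (e j.+1)^`M(i).

(* At x_i = 0 and x_j = 1 for j <> i only the derivative of e_n is left. *)
Let lagr_neq0 i : lagr i != 0.
Proof.
have n_gt0 : (0 < n)%N by apply: leq_ltn_trans (ltn_ord i).
pose v j : F := (j != i)%:R.
have en : e n = 'X_[mesym1 setT].
  rewrite mesymE (big_pred1 setT) // => h /=.
  by rewrite -[X in _ == X]card_ord -cardsT eqEcard subsetT /= eqn_leq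
    (subset_leq_card (subsetT h)).
suff : (lagr i).@[v] = 1 by apply: contra_eq_neq => ->;
  rewrite meval0 eq_sym oner_neq0.
rewrite /lagr raddf_sum /=; have ltpn : (n.-1 < n)%N by rewrite prednK.
rewrite (bigD1 (Ordinal ltpn)) //= big1 => [|j nej].
  rewrite prednK // subnn mul1r en mderiv_mesym1 inE addr0 mevalX big1 // =>
    j _.
  by rewrite mnmE !inE /v; case: (j != i).
rewrite rmorphM rmorphXn /= rmorphN /= mevalXU /v eqxx oppr0 expr0n.
rewrite subn_eq0 leqNgt (_ : (j.+1 < n)%N); first by rewrite mul0r.
rewrite ltn_neqAle ltn_ord andbT; apply: contra nej => /eqP ej.
by apply/eqP/val_inj; move/(congr1 predn): ej.
Qed.

Let span_dx i : span (lagr i *: dx F i).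
Proof.
pose z : P := - 'X_i.
(* P(-x_i) = 0 *)
have Pz : \sum_(j < n.+1) z ^+ (n - j) * e j = 0.
  have := mderiv_mesymE F n i; rewrite mesym_geqnE // mderiv0 => /esym.
  rewrite (reindex_inj rev_ord_inj) /= => {2}<-; apply: eq_bigr => j _.
  by rewrite subSS subKn // leq_ord.
(* (z + x_l) times the l-th component of dP is P *)
have G l : l != i -> \sum_(j < n) z ^+ (n - j.+1) * (e j.+1)^`M(l) = 0.
  move=> neli; have nzl : 'X_l + z != 0.
    rewrite subr_eq0; apply: contra neli => /eqP eX; have := mcoeffXU F l i.
    by rewrite eX mcoeffXU eqxx; case: (l == i) => // /eqP; rewrite oner_eq0.
  apply: (mulfI nzl); rewrite mulr0 -[RHS]Pz mulrDl !mulr_sumr.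
  pose d j := (e j)^`M(l).
  have -> : \sum_(j < n) z * (z ^+ (n - j.+1) * d j.+1) =
            \sum_(j < n.+1) z ^+ (n - j) * d j.+1.
    rewrite [RHS]big_ord_recr /= /d mesym_geqnE // mderiv0 mulr0 addr0.
    by apply: eq_bigr => j _; rewrite mulrA -exprS -subSn // subSS.
  have -> : \sum_(j < n) 'X_l * (z ^+ (n - j.+1) * d j.+1) =
            \sum_(j < n.+1) z ^+ (n - j) * ('X_l * d j).
    rewrite [RHS]big_ord_recl /= /d mesym0E -mpolyC1 mderivC !mulr0 add0r.
    by apply: eq_bigr => j _; rewrite mulrCA.
  rewrite -big_split; apply: eq_bigr => j _ /=.
  by rewrite -mulrDr addrC mderiv_mesym.
have -> : lagr i *: dx F i = \sum_(j < n) z ^+ (n - j.+1) *: dform (e j.+1).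
  rewrite /dform; under [RHS]eq_bigr do rewrite scaler_sumr.
  rewrite exchange_big (bigD1 i) //= [X in _ + X]big1 => [|l neli].
    rewrite addr0 /lagr scaler_suml; apply: eq_bigr => j _.
    by rewrite scalerA.
  rewrite -[RHS](scale0r (dx F l)) -(G _ neli) scaler_suml.
  by apply: eq_bigr => j _; rewrite scalerA.
by apply: span_sum => j; apply: spanZ; apply: span_mesym.
Qed.

(** Since a nonzero multiple of each dx_i is a combination of the n one-forms
    xi_k, a nonzero multiple of the volume form is a multiple of the product of
    the xi_k. *)
Lemma prod_xi_neq0 : \prod_(k < n) xi k != 0.
Proof.
have alt : alternating (fun k : 'I_n => xi k).
  by apply: ext_homog1_alternating => k; apply: xi_homog.
have [b hb] : exists b : 'I_n -> extalg P n, forall i, ext_homog 1 (b i) /\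
    ext_lift (fun k : 'I_n => xi k) idfun (b i) = lagr i *: dx F i.
  have /fin_all_exists[b hb] : forall i, exists b : extalg P n, ext_homog 1 b /\
      ext_lift (fun k : 'I_n => xi k) idfun b = lagr i *: dx F i.
    by move=> i; have [b] := span_dx i; exists b.
  by exists b.
have prodE : \prod_i b i = (\prod_i b i) setT *: \prod_i ext_gen P i.
  have hom : ext_homog n (\prod_i b i).
    have := @ext_homog_prod P n _ (index_enum 'I_n) b (fun i => (hb i).1).
    by rewrite (_ : size _ = n) // ord_index_enumE size_enum_ord.
  rewrite {1}(ext_decomp (\prod_i b i)) (bigD1 setT) //= [X in _ + X]big1.
    by rewrite addr0; congr (_ *: _); apply: eq_bigl => i; rewrite inE.
  move=> I neI; rewrite hom ?scale0r //; apply: contra neI => /eqP cI.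
  by rewrite eqEcard subsetT cardsT card_ord cI leqnn.
apply/negP => /eqP xi0.
have := congr1 (ext_lift (fun k : 'I_n => xi k) idfun) prodE.
rewrite (ext_liftZ idfun) !(ext_lift_bigprod idfun) //.
under [X in _ = _ *: X]eq_bigr do rewrite (ext_lift_gen idfun).
rewrite xi0 scaler0; under eq_bigr do rewrite (hb _).2.
rewrite scaler_prod => /ext_scale_eq0 h.
have nzl : \prod_i lagr i != 0 by apply/prodf_neq0 => i _; apply: lagr_neq0.
have /ffunP/(_ setT) := h nzl.
have := prod_ext_genE P [set: 'I_n] setT.
rewrite eqxx (eq_bigl xpredT) => [->|i]; last by rewrite inE.
by rewrite ext0E => /eqP; rewrite oner_eq0.
Qed.
End XiForms.

Section Realize.
Variables (F : numFieldType) (n : nat).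
Hypothesis n_gt0 : (0 < n)%N.
Local Notation P := {mpoly F[n]}.
Local Notation u := (u F n).
Local Notation xi := (xi F n).

Definition us : n.-1.-tuple P := [tuple u i.+1 | i < n.-1].
Definition xis (i : 'I_n.-1) : pform F n := xi i.+1.

Lemma realizeE (a : fmodel F n) : realize a = ext_lift xis (comp_mpoly us) a.
Proof. by []. Qed.

Lemma xis_homog i : ext_homog 1 (xis i).
Proof. exact: xi_homog. Qed.

Lemma xis_alternating : alternating xis.
Proof. exact: ext_homog1_alternating xis_homog. Qed.

Lemma prod_xis_neq0 : \prod_i xis i != 0.
Proof.
rewrite /xis; move: n_gt0 (@prod_xi_neq0 F n); case: n => // m _.
rewrite big_ord_recl; apply: contra_neq.
by rewrite (eq_bigr (fun i : 'I_m => Defs.xi F m.+1 i.+1)) // => ->;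
  rewrite mulr0.
Qed.

(** Differentiating a relation g(u) = 0 gives the relations (d_l g)(u) = 0 of
    lower degree, because the du_l are linearly independent. *)
Lemma u_alg_indep (g : {mpoly F[n.-1]}) : g \mPo us = 0 -> g = 0.
Proof.
have [r] := ubnP (msize g); elim: r => // r IHr in g *; rewrite ltnS => szg g0.
have nat_inj c k : c *+ k.+1 = 0 -> c = 0 :> F.
  by move/eqP; rewrite mulrn_eq0 => /eqP.
have dg0 l : g^`M(l) = 0.
  have [//|nz_dg] := eqVneq g^`M(l) 0.
  have supp m : m \in msupp g^`M(l) -> ((mdeg m).+1 < msize g)%N.
    rewrite -[_ \in _]negbK -mcoeff_eq0 mcoeff_mderiv => nz.
    have -> : (mdeg m).+1 = mdeg (m + U_(l))%MM by rewrite mdegD mdeg1 addn1.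
    by apply: msize_mdeg_lt; rewrite -[_ \in _]negbK -mcoeff_eq0;
      apply: contra_neq nz => ->;
       rewrite mul0rn.
  apply: IHr.
    by apply: leq_trans szg; rewrite -(mlead_deg nz_dg); apply: supp;
      apply: mlead_supp.
  pose p : extalg P n.-1 := \sum_j ((g^`M(j) \mPo us) * j.+2%:R) *: ext_gen P j.
  have p0 : ext_lift xis idfun p = 0.
    rewrite (ext_lift_sum idfun) -[RHS](dformC n 0) mpolyC0 -g0 dform_comp.
    apply: eq_bigr => j _; rewrite (ext_liftZ idfun) (ext_lift_gen idfun).
    by rewrite tnth_mktuple dform_u scalerA.
  have /ffunP/(_ [set l]) := ext_lift_inj xis_alternating prod_xis_neq0 p0.
  rewrite ext0E ext_sumE (bigD1 l) //= big1 => [|j neji]; last first.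
    by rewrite extZE ffunE (inj_eq set1_inj) eq_sym (negPf neji) mulr0.
  rewrite addr0 extZE ffunE eqxx mulr1 => /eqP; rewrite mulf_eq0.
  by rewrite -mpolyC_nat mpolyC_eq0 pnatr_eq0 orbF => /eqP.
(* In characteristic zero, g is then constant. *)
have gC : g = (g@_0)%:MP.
  apply/mpolyP => m; rewrite mcoeffC; have [->|nz_m] := eqVneq m 0%MM.
    by rewrite mulr1.
  rewrite mulr0; have [l ml] : exists l, (0 < m l)%N.
    apply/existsP; apply: contraNT nz_m; rewrite negb_exists => /forallP m0.
    by apply/eqP/mnmP => l; rewrite mnm0E; apply/eqP; have := m0 l;
      rewrite -leqNgt leqn0.
  have := congr1 (mcoeff (m - U_(l))) (dg0 l); rewrite mcoeff_mderiv mcoeff0.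
  move/nat_inj; rewrite submK //; apply/mnm_lepP => j; rewrite mnm1E.
  by case: eqP => [<-|].
move: g0 gC; move: g@_0 => c g0 gC; rewrite gC comp_mpolyC in g0.
by rewrite gC; move/eqP: g0; rewrite mpolyC_eq0 => /eqP->.
Qed.

Lemma realize_inj : injective (@realize F n).
Proof.
move=> a b /eqP; rewrite -subr_eq0 !realizeE -ext_liftB => /eqP ab0.
apply/eqP; rewrite -subr_eq0; apply/eqP/ffunP => J; rewrite ext0E.
pose p : extalg P n.-1 := [ffun J : {set _} => (a - b) J \mPo us].
have p0 : ext_lift xis idfun p = 0.
  by rewrite -[RHS]ab0; apply: eq_bigr => I _; rewrite ffunE.
have /ffunP/(_ J) := ext_lift_inj xis_alternating prod_xis_neq0 p0.
by rewrite ffunE ext0E => /u_alg_indep.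
Qed.

Lemma coords_realize (a : fmodel F n) : coords (realize a) = a.
Proof.
rewrite /coords; case: classical_sets.xgetP => [x _ /realize_inj //|].
by move/(_ a).
Qed.
End Realize.

(** * Invariant forms are generated by power sums *)

Section InvariantForms.
Variables (F : numFieldType) (n : nat).
Local Notation P := {mpoly F[n]}.
Implicit Types (m : nat * bool) (l : seq (nat * bool)) (t : seq 'I_n).

(** A pair (a, b) stands for the one-variable form x^a, or x^a dx if b holds. *)
Definition monform m i : pform F n :=
  'X_i ^+ m.1 *: (if m.2 then dx F i else 1).
Definition powform m : pform F n := \sum_i monform m i.
Definition monprod l t : pform F n := \prod_(p <- zip l t) monform p.1 p.2.

Lemma monform_merge m m' i : monform m i * monform m' i =
  if m.2 && m'.2 then 0 else monform (m.1 + m'.1, m.2 || m'.2) i.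
Proof.
case: m m' => [a b] [a' b'];
  rewrite /monform /= -scalerAl -scalerAr scalerA -exprD.
have dx2 : dx F i * dx F i = 0 := (@ext_gen_alternating P n).1 i.
by case: b; case: b' => /=; rewrite ?dx2 ?scaler0 ?mulr1 ?mul1r.
Qed.

Lemma monform_swap m m' i j : monform m i * monform m' j =
  (-1) ^+ (m.2 && m'.2) * (monform m' j * monform m i).
Proof.
case: m m' => [a b] [a' b']; rewrite /monform /= -!scalerAl -!scalerAr !scalerA.
have dxC : dx F i * dx F j = - (dx F j * dx F i) :=
  (@ext_gen_alternating P n).2 i j.
rewrite [_ ^+ a * _]mulrC.
by case: b; case: b' => /=; rewrite ?dxC ?mulN1r ?scalerN ?mulr1 ?mul1r.
Qed.

(* A product with a one-variable form in a variable that already occurs is again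
   a monomial, up to a constant that depends only on the position. *)
Let absorb i0 m l j : (j < size l)%N ->
  exists c : F, exists2 l', size l' = size l &
  forall t, size t = size l ->
    monform m (nth i0 t j) * monprod l t = c%:MP *: monprod l' t.
Proof.
elim: l j => // m0 l IHl [|j] /= ltj.
  exists (~~ (m.2 && m0.2))%:R, ((m.1 + m0.1, m.2 || m0.2)%N :: l) => //.
  case=> // i t _; rewrite /monprod /= !big_cons /= mulrA monform_merge.
  by case: ifP => _; rewrite ?mpolyC1 ?mpolyC0 ?scale1r ?scale0r ?mul0r.
have [c [l' szl' Hl']] := IHl j ltj.
exists ((-1) ^+ (m.2 && m0.2) * c), (m0 :: l') => [|[//|i t] [szt]];
  first by rewrite /= szl'.
rewrite /monprod /= !big_cons /= -/(monprod l t) -/(monprod l' t).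
rewrite mulrA monform_swap -!mulrA Hl' // -scalerAr mpolyCM -scalerA
  rmorph_sign.
by rewrite ext_sign.
Qed.

(** For r = n these are the symmetrisations of monomials under S_n, and smaller r
    are needed to reach them by adding one index at a time. *)
Definition symform r l : pform F n :=
  \sum_(t : r.-tuple 'I_n | uniq t) monprod l t.

Let big_tupleS r (G : seq 'I_n -> pform F n) :
  \sum_(t : r.+1.-tuple 'I_n | uniq t) G t =
  \sum_(t : r.-tuple 'I_n | uniq t) \sum_(i | i \notin t) G (i :: t).
Proof.
rewrite pair_big_dep /=.
rewrite (reindex (fun p : r.-tuple 'I_n * 'I_n => [tuple of p.2 :: p.1])) /=.
  by apply: eq_bigl => p; rewrite andbC.
exists (fun t : r.+1.-tuple 'I_n => ([tuple of behead t], thead t)) =>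
  [[t i] _|t _] /=.
  by congr (_, _); apply: val_inj.
by rewrite [t in RHS]tuple_eta; apply: val_inj.
Qed.

Section Closure.
(* B contains the subalgebra generated by the power sums. *)
Variable B : pform F n -> Prop.
Hypotheses (B1 : B 1) (BD : forall p q, B p -> B q -> B (p + q))
  (BM : forall p q, B p -> B q -> B (p * q))
  (BZ : forall c p, B p -> B (c%:MP *: p)) (Bpow : forall m, B (powform m)).

Let B_sum T (s : seq T) (f : T -> pform F n) :
  (forall x, B (f x)) -> B (\sum_(x <- s) f x).
Proof.
move=> Bf; apply: (big_ind B) => //.
by rewrite -(scale0r 1) -mpolyC0; apply: BZ.
Qed.

(** Multiplying the symmetrisation of a monomial by a power sum adds a new
    index; it may agree with an old one, in which case the number of factors
    does not increase. *)
Lemma symform_closure r l : size l = r -> B (symform r l).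
Proof.
elim: r l => [|r IHr] [|m l] //= => [_|[szl]].
  rewrite /symform (big_pred1 [tuple]) /monprod ?big_nil // => t.
  by rewrite (tuple0 t) /=; apply/esym/eqP/val_inj.
have -> : symform r.+1 (m :: l) = powform m * symform r l +
    (-1)%:MP *: (\sum_(j < r) \sum_(t : r.-tuple 'I_n | uniq t)
       monform m (tnth t j) * monprod l t).
  rewrite /symform big_tupleS [X in _ + _ *: X]exchange_big /=.
  rewrite mpolyCN mpolyC1 scaleN1r.
  rewrite /powform mulr_sumr -sumrB; apply: eq_bigr => t ut.
  rewrite mulr_suml [X in _ = X - _](bigID (mem t)) /=.
  rewrite -(big_tuple _ _ t xpredT (fun i => monform m i * monprod l t))
    big_uniq //= addrAC subrr add0r.
  by apply: eq_bigr => i _; rewrite /monprod /= big_cons.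
apply: BD; first by apply: BM; [exact: Bpow | exact: IHr].
apply: BZ; apply: B_sum => j.
have [i0 _|no] := pickP (fun _ : 'I_n => true); last first.
  rewrite big_pred0 => [|t]; last by have := no (tnth t j).
  by rewrite -(scale0r 1) -mpolyC0; apply: BZ.
have ltj : (j < size l)%N by rewrite szl.
have [c [l' szl' Hl']] := absorb i0 m ltj.
have -> : \sum_(t : r.-tuple 'I_n | uniq t) monform m (tnth t j) * monprod l t =
          c%:MP *: symform r l'.
  rewrite /symform scaler_sumr; apply: eq_bigr => t _.
  by rewrite (tnth_nth i0) Hl' // size_tuple.
by apply: BZ; apply: IHr; rewrite szl'.
Qed.

Let sum_uniq_perm (G : seq 'I_n -> pform F n) :
  \sum_(t : n.-tuple 'I_n | uniq t) G t = \sum_(s : 'S_n) G [tuple s i | i < n].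
Proof.
pose h (t : n.-tuple 'I_n) : 'S_n := insubd (1%g : 'S_n) [ffun i => tnth t i].
have hK (t : n.-tuple 'I_n) : uniq t -> [tuple h t i | i < n] = t.
  move=> ut; apply: eq_from_tnth => i; rewrite tnth_mktuple.
  rewrite -pvalE -[pval _]/(val (h t)) /h insubdK ?ffunE // -topredE /=.
  apply/injectiveP => a b; rewrite !ffunE; exact: (tuple_uniqP _ ut).
rewrite (reindex_onto (fun s : 'S_n => [tuple s i | i < n]) h) /=; last first.
  by move=> t ut; rewrite hK.
apply: eq_bigl => s.
have us : uniq [tuple s i | i < n].
  by rewrite map_inj_uniq ?enum_uniq //; apply: perm_inj.
rewrite us /=; apply/eqP/permP => i.
by have := congr1 (fun t : n.-tuple 'I_n => tnth t i) (hK _ us);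
  rewrite !tnth_mktuple.
Qed.

(** Averaging over the symmetric group writes an invariant form as a
    combination of symmetrisations of monomials. *)
Lemma invariant_closure phi : (forall s, sym_act s phi = phi) -> B phi.
Proof.
move=> inv; have nz : n`!%:R != 0 :> F by rewrite pnatr_eq0 -lt0n fact_gt0.
have -> : phi = (n`!%:R^-1)%:MP *: \sum_(s : 'S_n) sym_act s phi.
  rewrite (eq_bigr (fun _ => phi)) // sumr_const card_Sn -scaler_nat scalerA.
  by rewrite -mpolyC_nat -mpolyCM mulVf // scale1r.
apply: BZ; rewrite /sym_act exchange_big; apply: B_sum => I /=.
pose l (m : 'X_{1..n}) := [seq (m i, i \in I) | i <- enum 'I_n] :
  seq (nat * bool).
have -> : \sum_(s : 'S_n) msym s (phi I) *: \prod_(i in I) dx F (s i) =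
   \sum_(m <- msupp (phi I)) ((phi I)@_m)%:MP *: symform n (l m).
  have E (s : 'S_n) : msym s (phi I) *: \prod_(i in I) dx F (s i) =
     \sum_(m <- msupp (phi I)) ((phi I)@_m)%:MP *:
       monprod (l m) [tuple s i | i < n].
    rewrite {1}[phi I]mpolyE raddf_sum /= scaler_suml; apply: eq_bigr => m _.
    rewrite -mul_mpolyC rmorphM /= -scalerA.
    have -> : msym s (((phi I)@_m)%:MP) = ((phi I)@_m)%:MP.
      by rewrite -alg_mpolyC msymZ msym1.
    congr (_ *: _); rewrite /monprod /l zip_map big_map /=.
    rewrite -ord_index_enumE /monform /=.
    rewrite scaler_prod -big_mkcond mpolyXE_id rmorph_prod /=; congr (_ *: _).
    apply: eq_bigr => i _; rewrite rmorphXn /= msymX; congr ('X_[_] ^+ _).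
    apply/mnmP => j; rewrite !mnmE; congr (nat_of_bool _).
    by rewrite -(inj_eq (@perm_inj _ s)) permKV.
  under eq_bigr do rewrite E.
  rewrite exchange_big; apply: eq_bigr => m _ /=.
  by rewrite -scaler_sumr /symform (sum_uniq_perm (monprod (l m))).
apply: B_sum => m; apply: BZ; apply: symform_closure.
by rewrite size_map size_enum_ord.
Qed.

End Closure.
End InvariantForms.

(** * The model algebra maps onto the invariant forms on h *)

Section CoefficientModel.
Variables (F : numFieldType) (n : nat).
Hypothesis n_gt0 : (0 < n)%N.
Local Notation M := {mpoly F[n.-1]}.

(** The value at k = 0 is not an indeterminate but 0, because the series u has no
    constant term. *)
Definition uvar k : M :=
  if k is i.+1 then if insub i is Some j then 'X_j else 0 else 0.

(** The polynomials in the u_i that express the contractions of the xi_k, by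
    the recursion of qcoefS; keeping only its first summand gives the
    coefficients of the powers of the series u. *)
Fixpoint qmodel N k : M :=
  if N is N'.+1 then conv uvar (qmodel N') k + (n - k.+1)%:R *: qmodel N' k.+1
  else (k == 0%N)%:R.

Fixpoint wmodel N k : M :=
  if N is N'.+1 then conv uvar (wmodel N') k else (k == 0%N)%:R.

Lemma uvar_us k : (k < n)%N -> uvar k \mPo us F n = u_pos F n k.
Proof.
case: k => [|k] ltkn; first exact: comp_mpoly0.
have lt : (k < n.-1)%N by rewrite -ltnS prednK.
by rewrite /uvar insubT /= comp_mpolyXU -tnth_nth tnth_mktuple.
Qed.

Lemma qmodel_us N k : (k < n)%N -> qmodel N k \mPo us F n = qcoef F n N k.
Proof.
elim: N k => [|N IHN] k ltkn.
  by rewrite qcoef0 // /qmodel; case: eqP => _;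
    rewrite ?comp_mpoly0 ?comp_mpoly1.
rewrite qcoefS //= raddfD /= comp_mpolyZ; congr (_ + _).
  rewrite raddf_sum /=; apply: eq_bigr => i _.
  have lein : (i < n)%N by apply: leq_ltn_trans ltkn; apply: leq_ord.
  by rewrite rmorphM /= uvar_us // IHN // (leq_ltn_trans (leq_subr _ _)).
move: ltkn; rewrite leq_eqVlt => /predU1P[->|ltSk]; last by rewrite IHN.
by rewrite subnn !scale0r.
Qed.

(** These power sums are n times the q_(N,0), which the recursion expresses by
    the u_i. *)
Lemma xpowsum_us N : exists g : M, g \mPo us F n = xpowsum F n N.
Proof.
by exists (n%:R *: qmodel N 0); rewrite comp_mpolyZ qmodel_us // xpowsumE.
Qed.
End CoefficientModel.

Section Surjectivity.
Variables (F : numFieldType) (n : nat).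
Hypothesis n_gt0 : (0 < n)%N.
Local Notation P := {mpoly F[n]}.

Definition xts : n.-tuple P := [tuple xtilde F i | i < n].
Definition dxt (i : 'I_n) : pform F n :=
  dx F i - (n%:R^-1 : F)%:MP *: \sum_(j < n) dx F j.
(** Restriction of forms to h followed by extension to F^n: x_i and dx_i are
    replaced by their orthogonal projections. *)
Definition proj_h : pform F n -> pform F n := ext_lift dxt (comp_mpoly xts).

Lemma dxt_alternating : alternating dxt.
Proof.
apply: ext_homog1_alternating => i; apply: ext_homogD;
  first exact: ext_homog_gen.
rewrite -scaleN1r; do 2!apply: ext_homogZ.
by apply: ext_homog_sum => j _; apply: ext_homog_gen.
Qed.

Lemma in_R_proj p : in_R p -> p \mPo xts = p.
Proof.
elim=> [c|i j|q r _ IHq _ IHr|q r _ IHq _ IHr].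
- exact: comp_mpolyC.
- rewrite raddfB /= !comp_mpolyXU -!tnth_nth !tnth_mktuple /xtilde.
  by rewrite opprB addrA subrK.
- by rewrite raddfD /= IHq IHr.
- by rewrite rmorphM /= IHq IHr.
Qed.

Lemma in_H_proj phi : in_H phi -> proj_h phi = phi.
Proof.
case=> hR hE _; rewrite -[RHS]hE; apply: eq_bigr => I _.
by rewrite in_R_proj.
Qed.

Let dform_xtilde i : dform (xtilde F i) = dxt i.
Proof.
have dX (j : 'I_n) : dform ('X_j : P) = dx F j.
  apply/ffunP => J; rewrite dformE ffunE (bigD1 j) //= big1 => [|l nelj].
    by rewrite mderivXU eqxx mul1r addr0.
  by rewrite mderivXU (negPf nelj) mul0r.
rewrite /xtilde -scaleN1r dformD !dformZ dX mpolyCN mpolyC1 scaleN1r /dxt.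
congr (_ - _ *: _); rewrite (big_morph _ (@dformD F n) (dformC n 0)).
by apply: eq_bigr => j _; rewrite dX.
Qed.

(* The projection of sum_i x_i^k dx_i is d (sum_i xtilde_i^(k+1)) / (k+1), the
   differential of a polynomial in the u_l, hence a combination of the xi_l. *)
Let proj_h_powform m : exists a, realize a = proj_h (powform F n m).
Proof.
case: m => k b; rewrite /proj_h /powform ext_lift_sum /monform /=.
have [g gE] := xpowsum_us F n_gt0 k.+1; have [g0 g0E] := xpowsum_us F n_gt0 k.
have powE (i : 'I_n) : ('X_i ^+ k : P) \mPo xts = xtilde F i ^+ k.
  by rewrite rmorphXn /= comp_mpolyXU -tnth_nth tnth_mktuple.
case: b; last first.
  exists (g0 *: 1); rewrite realizeE ext_liftZ ext_lift1 /= g0E /xpowsum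
    scaler_suml.
  by apply: eq_bigr => i _; rewrite ext_liftZ ext_lift1 /= powE.
exists (\sum_l ((k.+1%:R^-1)%:MP * g^`M(l) * l.+2%:R) *: ext_gen _ l).
transitivity ((k.+1%:R^-1)%:MP *: dform (g \mPo us F n)).
  rewrite dform_comp scaler_sumr realizeE ext_lift_sum; apply: eq_bigr => l _.
  rewrite ext_liftZ ext_lift_gen /= !rmorphM /= comp_mpolyC tnth_mktuple
    dform_u.
  by rewrite !scalerA rmorph_nat.
rewrite gE /xpowsum (big_morph _ (@dformD F n) (dformC n 0)) scaler_sumr.
apply: eq_bigr => i _; rewrite ext_liftZ ext_lift_gen /= powE -dform_xtilde.
rewrite /xpow; set x := xtilde F i.
have dX r : dform (x ^+ r.+1) = (r.+1%:R * x ^+ r) *: dform x.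
  elim: r => [|r IHr]; first by rewrite mulr1 scale1r.
  rewrite exprS dformM IHr !scalerA -scalerDl; congr (_ *: _).
  by rewrite exprS; ring.
rewrite dX scalerA mulrA -mpolyC_nat -mpolyCM mulVf ?pnatr_eq0 //.
by rewrite mul1r.
Qed.

(** Solomon's theorem for the symmetric group: a form in H is its own
    projection, and the projections of invariant forms are generated by those
    of the power sums. *)
Lemma realize_surj phi : in_H phi -> exists a : fmodel F n, realize a = phi.
Proof.
move=> phiH; rewrite -(in_H_proj phiH); case: phiH => _ _ inv.
pose B psi := exists a : fmodel F n, realize a = proj_h psi.
rewrite -/(B phi); apply: invariant_closure inv.
- by exists 1; rewrite realizeE /proj_h !ext_lift1.
- move=> p q [a ea] [b eb]; exists (a + b).
  by rewrite realizeE /proj_h !ext_liftD -!realizeE ea eb.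
- move=> p q [a ea] [b eb]; exists (a * b).
  rewrite realizeE ext_liftM; last exact: xis_alternating.
  rewrite -!realizeE ea eb; apply/esym; exact: ext_liftM dxt_alternating _ _.
- move=> c p [a ea]; exists (c%:MP *: a).
  by rewrite realizeE /proj_h !ext_liftZ -realizeE ea /= !comp_mpolyC.
exact: proj_h_powform.
Qed.
End Surjectivity.

(** * The filtration and the leading part of the contraction *)

Section Degrees.
Variables (F : numFieldType) (n : nat).
Local Notation M := {mpoly F[n.-1]}.

Definition udeg (m : 'X_{1..n.-1}) : int :=
  \sum_(i < n.-1) (1 - i.+1%:Z) *+ m i.

(** For Q an equality with d, or an upper bound d, this is homogeneity or
    membership in a filtration level. *)
Definition usupp (Q : int -> Prop) (p : M) :=
  forall m, m \in msupp p -> Q (udeg m).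

Lemma udegD m1 m2 : udeg (m1 + m2)%MM = udeg m1 + udeg m2.
Proof. by rewrite /udeg -big_split; apply: eq_bigr => i _;
  rewrite mnmDE mulrnDr. Qed.

Lemma usupp0 Q : usupp Q 0.
Proof. by move=> m; rewrite msupp0. Qed.

Lemma usupp1 (Q : int -> Prop) : Q 0 -> usupp Q 1.
Proof.
move=> Q0 m; rewrite -mpolyC1 msuppC oner_eq0 inE => /eqP->.
by rewrite /udeg big1 // => i _; rewrite mnm0E.
Qed.

Lemma usuppD Q p q : usupp Q p -> usupp Q q -> usupp Q (p + q).
Proof. by move=> Hp Hq m /msuppD_le; rewrite mem_cat => /orP[/Hp|/Hq]. Qed.

Lemma usupp_sum Q (T : Type) (r : seq T) (f : T -> M) :
  (forall t, usupp Q (f t)) -> usupp Q (\sum_(t <- r) f t).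
Proof.
by move=> Hf; apply: (big_ind (usupp Q)); [exact: usupp0 | exact: usuppD |].
Qed.

Lemma usuppZ Q c p : usupp Q p -> usupp Q (c *: p).
Proof. by move=> Hp m /msuppZ_le/Hp. Qed.

Lemma usuppM (Q1 Q2 Q : int -> Prop) p q :
  (forall a b, Q1 a -> Q2 b -> Q (a + b)) ->
  usupp Q1 p -> usupp Q2 q -> usupp Q (p * q).
Proof.
move=> QD Hp Hq m /msuppM_le /allpairsP [[m1 m2] /= [m1p m2q ->]].
by rewrite udegD; apply: QD; [exact: Hp | exact: Hq].
Qed.

Lemma usuppS (Q Q' : int -> Prop) p :
  (forall a, Q a -> Q' a) -> usupp Q p -> usupp Q' p.
Proof. by move=> QQ' Hp m /Hp /QQ'. Qed.

Lemma uvar_deg k : usupp (fun a => a = 1 - k%:Z) (uvar F n k).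
Proof.
case: k => [|k]; first exact: usupp0.
rewrite /uvar; case: insubP => [j _ <-|_]; last exact: usupp0.
move=> m; rewrite msuppX inE => /eqP->; rewrite /udeg (bigD1 j) //= big1.
  by rewrite mnm1E eqxx addr0.
by move=> i neij; rewrite mnm1E eq_sym (negPf neij).
Qed.

Lemma wmodel_deg N k : usupp (fun a => a = N%:Z - k%:Z) (wmodel F n N k).
Proof.
elim: N k => [|N IHN] k /=.
  by case: k => [|k]; [apply: usupp1 | apply: usupp0].
refine (@usupp_sum _ _ _ _ _) => i;
  refine (usuppM _ (@uvar_deg i) (IHN (k - i)%N)) => a b -> ->.
by have := leq_ord i; lia.
Qed.

(** Passing from N to N + 1 raises the degree by one through the product with u,
    while q_(N,k+1) has degree at least two less than the leading term of
    qmodel N.+1 k. *)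
Lemma qmodel_deg N k :
  usupp (fun a => a <= N%:Z - k%:Z - 1) (qmodel F n N k - wmodel F n N k).
Proof.
elim: N k => [|N IHN] k /=; first by rewrite subrr; apply: usupp0.
have -> : conv (uvar F n) (qmodel F n N) k + (n - k.+1)%:R *: qmodel F n N k.+1
    - conv (uvar F n) (wmodel F n N) k =
  conv (uvar F n) (fun j => qmodel F n N j - wmodel F n N j) k
    + (n - k.+1)%:R *:
        (qmodel F n N k.+1 - wmodel F n N k.+1 + wmodel F n N k.+1).
  rewrite subrK addrAC -sumrB; congr (_ + _).
  by apply: eq_bigr => i _; rewrite mulrBr.
apply: usuppD.
  refine (@usupp_sum _ _ _ _ _) => i;
    refine (usuppM _ (@uvar_deg i) (IHN (k - i)%N)) => a b -> le_b.
  by have := leq_ord i; lia.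
apply: usuppZ; apply: usuppD.
  by apply: usuppS (IHN _) => a; lia.
by apply: usuppS (@wmodel_deg _ _) => a; lia.
Qed.

Definition fsupp (Q : int -> Prop) (a : fmodel F n) :=
  forall J m, m \in msupp (a J) -> Q (fdeg J m).

Lemma all_fdegsP (Q : pred int) a : all Q (fdegs a) <-> fsupp Q a.
Proof.
split=> [/allP Ha J m mJ|Ha]; last first.
  apply/allP => e; rewrite mem_undup => /allpairsPdep[J [m [_ mJ ->]]].
  exact: Ha.
apply: Ha; rewrite mem_undup; apply/allpairsPdep.
by exists J, m; rewrite mem_enum.
Qed.

Lemma fsuppD Q a b : fsupp Q a -> fsupp Q b -> fsupp Q (a + b).
Proof.
by move=> Ha Hb J m; rewrite extDE => /msuppD_le;
  rewrite mem_cat => /orP[/Ha|/Hb].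
Qed.

Lemma fsuppN Q a : fsupp Q a -> fsupp Q (- a).
Proof. by move=> Ha J m; rewrite extNE (perm_mem (msuppN _)) => /Ha. Qed.

(** Contracting the i-th odd generator, which stands for xi_(i+1), removes its
    degree -(i+1). *)
Lemma fsupp_contraction (Q1 Q2 Q : int -> Prop) (w : 'I_n.-1 -> M)
    (a : fmodel F n) :
  (forall x y, Q1 x -> Q2 y -> Q (x + y)) ->
  (forall i : 'I_n.-1, usupp (fun x => Q1 (x + i.+1%:Z)) (w i)) ->
  fsupp Q2 a -> fsupp Q (contraction w a).
Proof.
move=> QD Hw Ha J; rewrite contractionE => m.
suff : usupp (fun x => Q (x - \sum_(j in J) j.+1%:Z))
  (\sum_(i | i \notin J)
     (-1) ^+ #|[set j in J | (j < i)%N]| * (w i * a (i |: J))).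
  by apply.
rewrite [X in usupp _ X]big_mkcond; refine (@usupp_sum _ _ _ _ _) => i;
  case: ifPn => niJ; last exact: usupp0.
have -> : (-1) ^+ #|[set j in J | (j < i)%N]| * (w i * a (i |: J)) =
   ((-1) ^+ #|[set j in J | (j < i)%N]| : F) *: (w i * a (i |: J)).
  by rewrite -mul_mpolyC rmorph_sign.
have Ha' : usupp (fun x => Q2 (x - \sum_(j in i |: J) j.+1%:Z)) (a (i |: J)).
  exact: Ha.
refine (usuppZ (usuppM _ (Hw i) Ha')) => x y Q1x Q2y.
have := QD _ _ Q1x Q2y; rewrite (big_setU1 _ niJ) /=.
by congr (Q _); ring.
Qed.

Lemma fsupp_fcomp d (a : fmodel F n) : fsupp (fun e => e = d) (fcomp d a).
Proof.
move=> J; rewrite ffunE => m.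
suff : usupp (fun x => x - \sum_(j in J) j.+1%:Z = d)
    (\sum_(m <- msupp (a J) | fdeg J m == d) (a J)@_m *: 'X_[m]) by apply.
rewrite [X in usupp _ X]big_mkcond; refine (@usupp_sum _ _ _ _ _) => m';
  case: ifP => [/eqP dm'|_]; last exact: usupp0.
by refine (usuppZ _) => m''; rewrite msuppX inE => /eqP->.
Qed.

Lemma sum_fcomp (a : fmodel F n) : \sum_(d <- fdegs a) fcomp d a = a.
Proof.
apply/ffunP => J; rewrite ext_sumE [RHS]mpolyE.
under eq_bigr do rewrite ffunE.
rewrite (exchange_big_dep xpredT) //=; apply: eq_big_seq => m mJ.
rewrite (eq_bigl (pred1 (fdeg J m))) => [|d]; last exact: eq_sym.
rewrite -big_filter filter_pred1_uniq ?undup_uniq ?big_seq1 //.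
rewrite mem_undup; apply/allpairsPdep.
by exists J, m; rewrite mem_enum.
Qed.

Lemma fsupp_disjoint (Q Q' : int -> Prop) (a : fmodel F n) :
  (forall x, Q x -> ~ Q' x) -> fsupp Q a -> fsupp Q' a -> a = 0.
Proof.
move=> QQ' Ha Ha'; apply/ffunP => J; rewrite ext0E; apply/mpolyP => m.
rewrite mcoeff0; apply/eqP; rewrite mcoeff_eq0; apply/negP => mJ.
by apply: (QQ' _ (Ha _ _ mJ)); apply: Ha'.
Qed.
End Degrees.

Section GradedDifferential.
Variables (F : numFieldType) (n N : nat).
Hypothesis n_gt0 : (0 < n)%N.

(** The leading part, for the filtration, of the contraction *)
Definition dmodel (a : fmodel F n) : fmodel F n :=
  contraction (fun i : 'I_n.-1 => wmodel F n N i.+1) a.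

(* The contraction itself, transported to the model *)
Let dfull (a : fmodel F n) : fmodel F n :=
  contraction (fun i : 'I_n.-1 => qmodel F n N i.+1) a.

(** The contraction comes from the model because its values on the xi_i are
    polynomials in the u_i. *)
Lemma partialN_realize a : partialN N (realize a) = realize (dfull a).
Proof.
apply: (ext_lift_contraction (f := comp_mpoly (us F n)));
  first exact: xis_homog.
move=> i; have lti : (i.+1 < n)%N by rewrite -ltn_predRL.
rewrite contraction_homog1; last exact: xis_homog.
congr (_%:A); rewrite /= qmodel_us // /qcoef /vder_coef /vder scaler_sumr.
by apply: eq_bigr => j _; rewrite xi_set1 scalerAr.
Qed.

Lemma contraction_sub (w w' : 'I_n.-1 -> {mpoly F[n.-1]}) (a : fmodel F n) :
  contraction w a - contraction w' a = contraction (fun i => w i - w' i) a.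
Proof.
apply/ffunP => J; rewrite extDE extNE !contractionE -sumrB.
by apply: eq_bigr => i _; rewrite mulrBl mulrBr.
Qed.

(** The leading part is well defined, because an f-homogeneous element of
    strictly smaller filtration level is zero. *)
Lemma gr_partial_realize d a : fsupp (fun e => e = d) a ->
  gr_partial N d (realize a) = realize (dmodel a).
Proof.
move=> Ha.
have homog_d : fsupp (fun e => e = d + N%:Z) (dmodel a).
  refine (fsupp_contraction (Q1 := fun x => x = N%:Z) _ _ Ha) => [x y -> ->|i].
    exact: addrC.
  by refine (usuppS _ (@wmodel_deg F n N i.+1)) => x ->; rewrite subrK.
have filt_d : fsupp (fun e => e <= d + N%:Z - 1) (dfull a - dmodel a).
  rewrite /dfull /dmodel contraction_sub.
  refine (fsupp_contraction (Q1 := fun x => x <= N%:Z - 1) _ _ Ha) => [x y|i];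
    first lia.
  by refine (usuppS _ (@qmodel_deg F n N i.+1)) => x; lia.
apply: classical_sets.xget_unique.
  split; [exists (dmodel a) => // | exists (dfull a - dmodel a)].
  - by apply/all_fdegsP => J m mJ; apply/eqP; apply: homog_d mJ.
  - by apply/all_fdegsP.
  by rewrite realizeE ext_liftB -!realizeE partialN_realize.
move=> psi [[b /all_fdegsP Hb <-] [c /all_fdegsP Hc]].
rewrite partialN_realize !realizeE -ext_liftB -!realizeE.
move/(realize_inj n_gt0) => ec; congr (realize _); apply/eqP; rewrite -subr_eq0.
apply/eqP; apply: (@fsupp_disjoint F n (fun e => e = d + N%:Z)
  (fun e => e <= d + N%:Z - 1)) => [x ->|| ].
- by lia.
- by apply: fsuppD; [move=> J m /Hb/eqP | apply: fsuppN].
have -> : b - dmodel a = (dfull a - dmodel a) - c.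
  by rewrite ec opprB [RHS]addrC addrA subrK.
by apply: fsuppD => //; apply: fsuppN.
Qed.

Lemma dN_realize a : dN N (realize a) = realize (dmodel a).
Proof.
rewrite /dN coords_realize //.
rewrite (eq_bigr (fun d => realize (dmodel (fcomp d a)))) => [|d _]; last first.
  by apply: gr_partial_realize; apply: fsupp_fcomp.
rewrite -[in RHS](sum_fcomp a) /dmodel realizeE.
rewrite (big_morph _ (contractionD _) (contraction0 _)) ext_lift_sum.
by apply: eq_bigr.
Qed.
End GradedDifferential.

Section PowersOfU.
Variables (F : numFieldType) (n : nat).
Hypothesis n_gt0 : (0 < n)%N.
Local Notation P := {mpoly F[n]}.

Lemma wmodel_us N (v : {poly P}) i : (i < n)%N ->
  (forall l, (l <= i)%N -> v`_l = u_pos F n l) ->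
  wmodel F n N i \mPo us F n = (v ^+ N)`_i.
Proof.
move=> ltin vE; elim: N i ltin vE => [|N IHN] i ltin vE.
  by rewrite expr0 coef1 /=; case: eqP => _; rewrite ?comp_mpoly0 ?comp_mpoly1.
rewrite exprS coefM raddf_sum; apply: eq_bigr => l _ /=.
have lel := leq_ord l.
rewrite rmorphM /= uvar_us ?(leq_ltn_trans lel) // vE // IHN //.
  by apply: leq_ltn_trans ltin; apply: leq_subr.
by move=> j lej; apply: vE; apply: leq_trans lej _; apply: leq_subr.
Qed.

Lemma coef_expr_upos N i :
  ((\poly_(l < i.+1) u_pos F n l) ^+ N)`_i =
  \sum_(t : {ffun 'I_N -> 'I_i.+1} |
     [forall j, (1 <= t j)%N] && (\sum_(j < N) t j == i)%N)
     \prod_(j < N) u F n (t j).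
Proof.
have -> : (\poly_(l < i.+1) u_pos F n l) ^+ N =
    \prod_(j < N) \sum_(l < i.+1) u_pos F n l *: 'X^l :> {poly P}.
  by rewrite poly_def prodr_const card_ord.
rewrite bigA_distr_bigA coef_sum [RHS]big_mkcond /=; apply: eq_bigr => t _.
rewrite scaler_prod coefZ -expr_sum coefXn [i == _]eq_sym.
(* Tuples with a zero entry contribute nothing, since u_pos 0 = 0. *)
case: (boolP [forall j, _]) => [/forallP t1|]; last first.
  rewrite negb_forall => /existsP[j]; rewrite -leqNgt leqn0 => /eqP tj0.
  by rewrite (bigD1 j) //= tj0 /= mul0r mul0r.
case: eqP => _; rewrite ?mulr0 ?mulr1 //=.
by apply: eq_bigr => j _; have := t1 j; case: (t j : nat).
Qed.
End PowersOfU.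

(** * The differential *)

Section Differential.
Variables (F : numFieldType) (n N : nat).
Hypothesis n_gt0 : (0 < n)%N.
Local Notation d := (@dN F n N).
Local Notation u := (u F n).
Local Notation xi := (xi F n).

Lemma dN0 : d 0 = 0.
Proof.
have -> : (0 : pform F n) = realize (0 : fmodel F n).
  by rewrite realizeE ext_lift0.
by rewrite dN_realize // /dmodel contraction0.
Qed.

(** By surjectivity both factors come from the model algebra, where the leading
    part is again a contraction, hence an antiderivation. *)
Lemma dN_leibniz k (phi psi : pform F n) : in_Hk k phi -> in_H psi ->
  d (phi * psi) = d phi * psi + (-1) ^+ k * (phi * d psi).
Proof.
move=> [phiH phik] /(realize_surj n_gt0)[b <-].
have [a aE] := realize_surj n_gt0 phiH.
have alt := @xis_alternating F n.
have realizeM (p q : fmodel F n) : realize (p * q) = realize p * realize q.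
  by rewrite !realizeE ext_liftM.
have parE : realize (ext_parity a) = (-1) ^+ k *: phi.
  rewrite realizeE -ext_lift_parity; last exact: xis_homog.
  by rewrite -realizeE aE (ext_parity_homog (r := k)).
rewrite -[in LHS]aE -realizeM !dN_realize // -{1}aE dN_realize //.
rewrite /dmodel contractionM realizeE ext_liftD -!realizeE !realizeM parE.
by rewrite ext_sign scalerAl.
Qed.

Lemma dN_u i : (1 <= i < n)%N -> d (u i)%:A = 0.
Proof.
case: i => // i /=; rewrite -ltn_predRL => lti.
have -> : (u i.+1)%:A = realize ('X_(Ordinal lti) *: 1 : fmodel F n).
  rewrite realizeE ext_liftZ ext_lift1 /= comp_mpolyXU -tnth_nth tnth_mktuple.
  by [].
rewrite dN_realize // /dmodel contractionZ contraction1 scaler0.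
by rewrite realizeE ext_lift0.
Qed.

Lemma dN_xi i : (1 <= i < n)%N -> d (xi i) = (wmodel F n N i \mPo us F n)%:A.
Proof.
case: i => // i /=; rewrite -ltn_predRL => lti.
have -> : xi i.+1 = realize (ext_gen _ (Ordinal lti) : fmodel F n).
  by rewrite realizeE ext_lift_gen.
rewrite dN_realize // /dmodel contraction_homog1; last exact: ext_homog_gen.
rewrite realizeE ext_liftZ ext_lift1 /=; congr (_ \mPo _)%:A.
rewrite (bigD1 (Ordinal lti)) //= big1 => [|j nej]; rewrite ffunE.
  by rewrite eqxx mulr1 addr0.
by rewrite (inj_eq set1_inj) (negPf nej) mulr0.
Qed.

Lemma dN_generating : (1 <= N)%N ->
  take_poly n (map_poly d (\sum_(1 <= k < n) (xi k)%:P * 'X^k)) =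
  take_poly n ((\sum_(1 <= k < n) ((u k)%:A)%:P * 'X^k) ^+ N).
Proof.
move=> N_gt0; apply/polyP => i; rewrite !coef_take_poly; case: ifP => // ltin.
pose ut : {poly {mpoly F[n]}} := \sum_(1 <= k < n) (u k)%:P * 'X^k.
have coef_sum1 (A : nzRingType) (f : nat -> A) l : (l < n)%N ->
    (\sum_(1 <= k < n) (f k)%:P * 'X^k)`_l = if l is 0%N then 0 else f l.
  move=> ltln; rewrite coef_sum; under eq_bigr do rewrite coefCM coefXn.
  case: l ltln => [|l] ltln.
    rewrite big_nat big1 // => k /andP[k1 _].
    by case: k k1 => // k _; rewrite mulr0.
  rewrite (bigD1_seq l.+1) ?iota_uniq ?mem_index_iota //= eqxx mulr1.
  by rewrite big1 ?addr0 // => k nek; rewrite eq_sym (negPf nek) mulr0.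
have -> : \sum_(1 <= k < n) ((u k)%:A)%:P * 'X^k =
    map_poly (in_alg (pform F n)) ut.
  rewrite rmorph_sum /=; apply: eq_bigr => k _.
  by rewrite rmorphM /= map_polyC map_polyXn.
rewrite -rmorphXn coef_map /= (coef_map_id0 _ _ dN0) coef_sum1 //.
rewrite -(@wmodel_us F n n_gt0) // => [|l leli]; last first.
  by rewrite coef_sum1 //; apply: leq_ltn_trans ltin.
case: i ltin => [|i] ltin; last exact: dN_xi.
case: N N_gt0 dN0 => // N' _ /= ->; rewrite /conv big_ord1 mul0r comp_mpoly0.
by rewrite scale0r.
Qed.
End Differential.

Theorem proposition1p7 (R : realType) (n N : nat)
    (hn : (2 <= n)%N) (hN : (1 <= N)%N) :
  let d : pform R[i] n -> pform R[i] n := @dN R[i] n N in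
  let u : nat -> {mpoly R[i][n]} := @u R[i] n in
  let xi : nat -> pform R[i] n := @xi R[i] n in
  [/\ forall (k : nat) (phi psi : pform R[i] n),
        in_Hk k phi -> in_H psi ->
        d (phi * psi) = d phi * psi + (-1) ^+ k * (phi * d psi),
      forall i : nat, (1 <= i < n)%N -> d (u i)%:A = 0,
      forall i : nat, (1 <= i < n)%N ->
        d (xi i) =
          (\sum_(t : {ffun 'I_N -> 'I_i.+1} |
                 [forall j, (1 <= t j)%N] && (\sum_(j < N) t j == i)%N)
             \prod_(j < N) u (t j))%:A
    & let xi_t : {poly pform R[i] n} :=
        \sum_(1 <= k < n) (xi k)%:P * 'X^k in
      let u_t : {poly pform R[i] n} :=
        \sum_(1 <= k < n) ((u k)%:A)%:P * 'X^k in
      take_poly n (map_poly d xi_t) = take_poly n (u_t ^+ N)].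
Proof.
have n_gt0 : (0 < n)%N := ltnW hn.
move=> d u xi; split.
- exact: dN_leibniz n_gt0.
- exact: dN_u n_gt0.
- move=> i ltin; rewrite -coef_expr_upos /d /xi.
  have lt : (i < n)%N by case/andP: ltin.
  have vE l : (l <= i)%N ->
      (\poly_(l < i.+1) u_pos R[i] n l)`_l = u_pos R[i] n l.
    by move=> leli; rewrite coef_poly ltnS leli.
  rewrite -(wmodel_us n_gt0 N lt vE).
  exact: dN_xi n_gt0 _ ltin.
exact: dN_generating n_gt0 hN.
Qed.
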